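(* Let $\mathcal X=[a,b]\subset\mathbb R^d$ ($d\ge2$) be a hyperrectangle, $M>0$, and $\mathcal F=\{f:0\le f(x)\le M\ \forall x\in\mathcal X,\ f\text{ is orthounimodal about }a\text{ on }\mathcal X\}$. Suppose the sampling density $g$ satisfies $0<\inf_{x\in\mathcal X}g(x)\le\sup_{x\in\mathcal X}g(x)<\infty$, that $\int_{\mathcal X}|\phi_j(x)|^{1+\delta}dx<\infty$ for $j=0,\ldots,l$ and some $\delta>0$, and that there exists $L_0\in\mathcal L$ such that $\mathbb E_g[\phi_j(X)L_0(X)]<\mu_j$ for $j=1,\ldots,m$ and $\mathbb E_g[\phi_j(X)L_0(X)]=\mu_j$ for $j=m+1,\ldots,l$, with moreover $(\mu_{m+1},\ldots,\mu_l)$ an interior point of $\{(\mathbb E_g[\phi_{m+1}(X)L(X)],\ldots,\mathbb E_g[\phi_l(X)L(X)]):L\in\mathcal L\}$. Then the problem $(\mathcal P_n)$ is equivalent to the linear program $(\mathcal P_n')$ (i.e. $(\mathcal P_n)$ is finite-dimensionally reducible) with the discrete shape constraint $$L(X_i)g(X_i)\le L(X_j)g(X_j)\ \text{ if }X_i\ge X_j\text{ component-wise},\qquad 0\le L(X_i)g(X_i)\le M,\ i=1,\ldots,n.$$ Additionally, $|val(\mathcal P_n)-val(\mathcal P)|\overset{\text{a.s.*}}{\to}0$.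
   Context: Setting. $\phi_0,\ldots,\phi_l:\mathcal X\to\mathbb R$ are known functions, $0\le m\le l$, $\mu_1,\ldots,\mu_l\in\mathbb R$, and one of $\phi_1,\ldots,\phi_l$ is the indicator $I(x\in\mathcal X)$ (total mass constraint). $g$ is a positive probability density on $\mathcal X$ (the sampling distribution), $X,X_1,X_2,\ldots$ are i.i.d. with density $g$, $\mathbb E_g$ is expectation under $g$, and $\mathcal L=\{f/g:f\in\mathcal F\}$. Problem $(\mathcal P)$: $\sup_{L\in\mathcal L}\mathbb E_g[\phi_0(X)L(X)]$ subject to $\mathbb E_g[\phi_j(X)L(X)]\le\mu_j$ for $j=1,\ldots,m$ and $\mathbb E_g[\phi_j(X)L(X)]=\mu_j$ for $j=m+1,\ldots,l$. Problem $(\mathcal P_n)$ (the IW-SAA problem): $\sup_{L\in\mathcal L}\frac1n\sum_{i=1}^n\phi_0(X_i)L(X_i)$ subject to $\frac1n\sum_{i=1}^n\phi_j(X_i)L(X_i)\le\mu_j$ for $j=1,\ldots,m$ and $\frac1n\sum_{i=1}^n\phi_j(X_i)L(X_i)=\mu_j$ for $j=m+1,\ldots,l$. Problem $(\mathcal P_n')$: the same objective and moment constraints as $(\mathcal P_n)$, but with the real numbers $L(X_1),\ldots,L(X_n)$ as decision variables and with $L\in\mathcal L$ replaced by the stated discrete shape constraint. ''Equivalent'' / ''finite-dimensionally reducible'' means: the values at $X_1,\ldots,X_n$ of any $L\in\mathcal L$ satisfy the discrete shape constraint, and conversely any real numbers $L(X_1),\ldots,L(X_n)$ satisfying it are the values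 at $X_1,\ldots,X_n$ of some $L\in\mathcal L$; in particular $val(\mathcal P_n)=val(\mathcal P_n')$. For $a,b\in\mathbb R^d$, $a\le b$ is component-wise and $[a,b]=\{x\in\mathbb R^d:a\le x\le b\}$. A function $f$ is orthounimodal about $a=(a_1,\ldots,a_d)$ if for each $i$ and any fixed $x_j$, $j\ne i$, the map $x_i\mapsto f(x)$ is non-decreasing on $(-\infty,a_i]$ and non-increasing on $[a_i,\infty)$; on $\mathcal X=[a,b]$ this means $f$ is non-increasing in each coordinate. $val(\cdot)$ is the optimal value in $[-\infty,\infty]$ ($\sup\emptyset=-\infty$). If $l=m$ the interior point condition is vacuous. $T^*$ is the minimal measurable majorant of a map $T:\Omega\to[-\infty,\infty]$ (measurable, $T^*\ge T$, and $T^*\le U$ a.s. for every measurable $U\ge T$ a.s.). $Z_n\overset{\text{a.s.*}}{\to}Z$ means $|Z_n-Z|^*\to0$ almost surely. *)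

(* Defs.v *)
From HB Require Import structures.
From mathcomp Require Import all_boot all_order all_algebra.
From mathcomp Require Import all_classical all_reals all_analysis.
(* all_analysis does not export the sigma-algebra of \bar R *)
From mathcomp Require Import measurable_realfun.

Set Implicit Arguments.
Unset Strict Implicit.
Unset Printing Implicit Defensive.

Import Order.TTheory GRing.Theory Num.Theory.
Import numFieldNormedType.Exports.

Local Open Scope classical_set_scope.
Local Open Scope ring_scope.

(* R^d is [d.-tuple R] with its Borel sigma-algebra, the one generated by the
   coordinate maps. *)

Section lebesgue_cons.
Context (R : realType) (n : nat).

Definition tuple_cons (p : measurableTypeR R * n.-tuple R) : n.+1.-tuple R :=
  [tuple of p.1 :: p.2].

Lemma measurable_tuple_cons : measurable_fun setT tuple_cons.
Proof. by apply: measurable_cons. Qed.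

Variable m : {sigma_finite_measure set (n.-tuple R) -> \bar R}.

Definition lebesgue_cons : set (n.+1.-tuple R) -> \bar R :=
  pushforward (lebesgue_measure \x m)%E tuple_cons.

Let lebesgue_cons0 : lebesgue_cons set0 = 0%E.
Proof. by rewrite /lebesgue_cons /pushforward preimage_set0 measure0. Qed.

Let lebesgue_cons_ge0 A : (0 <= lebesgue_cons A)%E.
Proof. exact: (measure_ge0 (lebesgue_measure \x m)%E). Qed.

Let lebesgue_cons_sigma_additive : semi_sigma_additive lebesgue_cons.
Proof.
move=> F mF tF mUF; rewrite /lebesgue_cons /pushforward preimage_bigcup.
have mP A : measurable A -> measurable (tuple_cons @^-1` A).
  by move=> mA; rewrite -[X in measurable X]setTI; exact: measurable_tuple_cons.
apply: measure_semi_sigma_additive => //.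
- by move=> k; exact: mP.
- apply/trivIsetP => /= i j _ _ ij; rewrite -preimage_setI.
  by move/trivIsetP : tF => /(_ _ _ _ _ ij) ->//; rewrite preimage_set0.
- by rewrite -preimage_bigcup; exact: mP.
Qed.

HB.instance Definition _ := isMeasure.Build _ _ _ lebesgue_cons
  lebesgue_cons0 lebesgue_cons_ge0 lebesgue_cons_sigma_additive.

Let lebesgue_cons_sigma_finite : sigma_finite setT lebesgue_cons.
Proof.
have /sigma_finiteP[F [TF ndF Foo]] := sigma_finiteT (@lebesgue_measure R).
have /sigma_finiteP[G [TG ndG Goo]] := sigma_finiteT m.
pose u (t : n.+1.-tuple R) : measurableTypeR R * n.-tuple R :=
  (thead t, [tuple of behead t]).
have mu : measurable_fun setT u.
  apply/measurable_fun_pairP; split => /=.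
    exact: (measurable_tnth ord0).
  exact: measurable_behead.
have uK : cancel tuple_cons u.
  move=> [x t]; rewrite /u /tuple_cons/=; congr (_, _).
  by apply/val_inj.
exists (fun k => u @^-1` (F k `*` G k)).
  rewrite -preimage_bigcup (_ : \bigcup_k (F k `*` G k) = setT)//.
  apply/seteqP; split => // -[x y] _.
  have [k _ Fkx] : (\bigcup_k F k) x by rewrite -TF.
  have [l _ Gly] : (\bigcup_k G k) y by rewrite -TG.
  exists (maxn k l) => //; split => /=.
  - by move: x Fkx; exact/subsetPset/ndF/leq_maxl.
  - by move: y Gly; exact/subsetPset/ndG/leq_maxr.
move=> k; have [mFk Fk] := Foo k; have [mGk Gk] := Goo k; split.
  by rewrite -[X in measurable X]setTI; apply: mu => //; exact: measurableX.
rewrite /lebesgue_cons /pushforward -comp_preimage.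
rewrite (_ : u \o tuple_cons = id); last by apply/funext => x /=; rewrite uK.
by rewrite preimage_id product_measure1E// lte_mul_pinfty// ge0_fin_numE.
Qed.

HB.instance Definition _ := Measure_isSigmaFinite.Build _ _ _ lebesgue_cons
  lebesgue_cons_sigma_finite.

End lebesgue_cons.

(* Lebesgue measure on R^d: the d-fold product of the Lebesgue measure on R *)
Fixpoint lebesgue_tuple (R : realType) (d : nat) :
    {sigma_finite_measure set (d.-tuple R) -> \bar R} :=
  match d with
  | 0 => [the {sigma_finite_measure set _ -> \bar R} of \d_[tuple]]
  | n.+1 => [the {sigma_finite_measure set _ -> \bar R} of
      lebesgue_cons (lebesgue_tuple R n)]
  end.

Section box.
Context (R : realType) (d : nat).

Definition cle (x y : d.-tuple R) : Prop := forall i, tnth x i <= tnth y i.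

Definition box (a b : d.-tuple R) : set (d.-tuple R) :=
  [set x | cle a x /\ cle x b].

Definition orthounimodal_on (D : set (d.-tuple R)) (c : d.-tuple R)
    (f : d.-tuple R -> R) : Prop :=
  forall (i : 'I_d) (x y : d.-tuple R), D x -> D y ->
    (forall j, j != i -> tnth x j = tnth y j) -> tnth x i <= tnth y i ->
    (tnth y i <= tnth c i -> f x <= f y) /\
    (tnth c i <= tnth x i -> f y <= f x).

Definition shape_class (a b : d.-tuple R) (M : R) : set (d.-tuple R -> R) :=
  [set f | (forall x, box a b x -> 0 <= f x <= M) /\
           orthounimodal_on (box a b) a f].

End box.

Lemma measurable_box (R : realType) (d : nat) (a b : d.-tuple R) :
  measurable (box a b).
Proof.
rewrite (_ : box a b = \bigcap_(i in [set: 'I_d])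
    ((@tnth d R ^~ i) @^-1` `[tnth a i, tnth b i]%classic)).
  apply: fin_bigcap_measurable => // i _.
  by rewrite -[X in measurable X]setTI; apply: measurable_tnth.
apply/seteqP; split=> [x [ax xb] i _ /=|x xab].
  by rewrite in_itv/= ax xb.
by split=> i; move: (xab i Logic.I); rewrite /= in_itv/= => /andP[].
Qed.

Lemma lebesgue_tuple_box (R : realType) (d : nat) (a b : d.-tuple R) :
  cle a b ->
  lebesgue_tuple R d (box a b) = (\prod_(i < d) (tnth b i - tnth a i))%:E.
Proof.
elim: d a b => [|d IH] a b ab.
  rewrite big_ord0 /= diracE mem_set//.
  by split => -[].
pose a' : d.-tuple R := [tuple of behead a].
pose b' : d.-tuple R := [tuple of behead b].
have tE (t : d.+1.-tuple R) (i : 'I_d) :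
    tnth [tuple of behead t] i = tnth t (lift ord0 i).
  by rewrite [in RHS](tuple_eta t) tnthS.
have -> : lebesgue_tuple R d.+1 (box a b) =
    (lebesgue_measure \x lebesgue_tuple R d)%E
      (`[tnth a ord0, tnth b ord0]%classic `*` box a' b').
  rewrite /= /lebesgue_cons /pushforward; congr (_ _).
  apply/seteqP; split => -[x t].
    move=> [/= ax xb]; split => /=.
      by rewrite in_itv/=; move: (ax ord0) (xb ord0); rewrite tnth0 => -> ->.
    by split=> i; rewrite tE; [move: (ax (lift ord0 i))|move: (xb (lift ord0 i))];
      rewrite tnthS.
  move=> [/=]; rewrite in_itv/= => /andP[ax xb] [at' tb].
  split=> i; case: (unliftP ord0 i) => [j|] ->; rewrite ?tnth0 ?tnthS//.
    by rewrite -tE; exact: at'.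
  by rewrite -tE; exact: tb.
rewrite product_measure1E//; last exact: measurable_box.
rewrite [in LHS]/= lebesgue_measure_itv/= lte_fin.
rewrite big_ord_recl EFinM; congr (_ * _)%E.
  case: ltP => // ba; apply/esym; congr EFin; apply/eqP.
  by rewrite subr_eq0 eq_le ba ab.
rewrite IH; last by move=> i; rewrite !tE.
by congr EFin; apply: eq_bigr => i _; rewrite !tE.
Qed.

Section sampling.
Context (R : realType) (d : nat).
Local Notation Rd := (d.-tuple R).
Implicit Types (D : set Rd) (g : Rd -> R).

Definition is_pdf D g : Prop :=
  [/\ measurable_fun D g, (forall x, D x -> 0 < g x) &
      (\int[lebesgue_tuple R d]_(x in D) (g x)%:E = 1)%E].

Definition has_pdf (dO : measure_display) (Omega : measurableType dO)
    (P : probability Omega R) D g (X : {RV P >-> Rd}) : Prop :=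
  (forall w, D (X w)) /\
  forall A : set Rd, measurable A ->
    P (X @^-1` A) = (\int[lebesgue_tuple R d]_(x in A `&` D) (g x)%:E)%E.

Definition mutually_independent (dO : measure_display)
    (Omega : measurableType dO) (P : probability Omega R)
    (X : nat -> {RV P >-> Rd}) : Prop :=
  forall (J : seq nat) (A : nat -> set Rd), uniq J ->
    (forall i, measurable (A i)) ->
    P (\bigcap_(i in [set` J]) (X i @^-1` A i)) =
    (\prod_(i <- J) P (X i @^-1` A i))%E.

(* E_g[h(X)] for X with density g on D.  A coordinatewise monotone h is Lebesgue
   but in general not Borel measurable.  The integral is defined for every
   integrand, through the Borel simple functions below the positive and the
   negative part; it agrees with the integral against the completed measure
   whenever the integrand is almost everywhere equal to a Borel function. *)
Definition expect D g (h : Rd -> R) : \bar R :=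
  (\int[lebesgue_tuple R d]_(x in D) (h x * g x)%:E)%E.

Definition likelihood_ratios g (F : set (Rd -> R)) : set (Rd -> R) :=
  [set (fun x => f x / g x) | f in F].

End sampling.

(* phi 0 is the objective; phi j and mu j with 1 <= j <= m are the inequality
   constraints, those with m < j <= l the equality constraints. *)
Section problems.
Context (R : realType) (d : nat).
Local Notation Rd := (d.-tuple R).
Variables (l m : nat) (phi : nat -> Rd -> R) (mu : nat -> R).

Section population.
Variables (D : set Rd) (g : Rd -> R) (LL : set (Rd -> R)).

Definition moment (j : nat) (L : Rd -> R) : \bar R :=
  expect D g (fun x => phi j x * L x).

Definition feasible (L : Rd -> R) : Prop :=
  (forall j, (1 <= j <= m)%N -> (moment j L <= (mu j)%:E)%E) /\
  (forall j, (m < j <= l)%N -> moment j L = (mu j)%:E).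

Definition val_P : \bar R :=
  ereal_sup [set moment 0 L | L in [set L | LL L /\ feasible L]].

Definition strictly_feasible (L : Rd -> R) : Prop :=
  (forall j, (1 <= j <= m)%N -> (moment j L < (mu j)%:E)%E) /\
  (forall j, (m < j <= l)%N -> moment j L = (mu j)%:E).

Definition equality_moments : set 'rV[R]_(l - m) :=
  [set v : 'rV[R]_(l - m) | exists2 L, LL L &
     forall k : 'I_(l - m), moment (m + k.+1) L = (v 0 k)%:E].

Definition equality_levels : 'rV[R]_(l - m) := \row_k mu (m + k.+1)%N.

End population.

Section sample.
Variables (n : nat) (x : 'I_n -> Rd).

Definition sample_moment (j : nat) (w : 'I_n -> R) : R :=
  n%:R^-1 * \sum_(i < n) phi j (x i) * w i.

Definition sample_feasible (w : 'I_n -> R) : Prop :=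
  (forall j, (1 <= j <= m)%N -> sample_moment j w <= mu j) /\
  (forall j, (m < j <= l)%N -> sample_moment j w = mu j).

Definition val_Pn (LL : set (Rd -> R)) : \bar R :=
  ereal_sup [set (sample_moment 0 (L \o x))%:E |
             L in [set L | LL L /\ sample_feasible (L \o x)]].

Definition val_Pn' (shape : set ('I_n -> R)) : \bar R :=
  ereal_sup [set (sample_moment 0 w)%:E |
             w in [set w | shape w /\ sample_feasible w]].

End sample.
End problems.
Arguments equality_moments {R d} l m phi D g LL.
Arguments equality_levels {R} l m mu.

Section reduction.
Context (R : realType) (d n : nat).
Local Notation Rd := (d.-tuple R).

Definition finite_dim_reducible (LL : set (Rd -> R)) (x : 'I_n -> Rd)
    (shape : set ('I_n -> R)) : Prop :=
  (forall L, LL L -> shape (L \o x)) /\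
  (forall w, shape w -> exists2 L, LL L & forall i, L (x i) = w i).

Definition discrete_shape (g : Rd -> R) (M : R) (x : 'I_n -> Rd) :
    set ('I_n -> R) :=
  [set w | (forall i j, cle (x j) (x i) ->
              w i * g (x i) <= w j * g (x j)) /\
           (forall i, 0 <= w i * g (x i) <= M)].

End reduction.

Section outer_convergence.
Context (R : realType) (dO : measure_display) (Omega : measurableType dO).
Variable P : probability Omega R.

Definition minimal_majorant (T U : Omega -> \bar R) : Prop :=
  [/\ measurable_fun setT U, (forall w, (T w <= U w)%E) &
      forall V : Omega -> \bar R, measurable_fun setT V ->
        {ae P, forall w, (T w <= V w)%E} -> {ae P, forall w, (U w <= V w)%E}].

(* Minimal majorants always exist and are almost surely unique, so asking for
   some or for every version U n makes no difference. *)
Definition as_outer_cvg (Z : nat -> Omega -> \bar R) (z : \bar R) : Prop :=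
  exists U : nat -> Omega -> \bar R,
    (forall n, minimal_majorant (fun w => `|Z n w - z|%E) (U n)) /\
    {ae P, forall w, (U n w @[n --> \oo] --> 0%E)}.

End outer_convergence.

(* Main.v *)
From HB Require Import structures.
Require Import Defs.
From mathcomp Require Import all_boot all_order all_algebra.
From mathcomp Require Import all_classical all_reals all_analysis.
From mathcomp Require Import measurable_realfun.
From mathcomp Require Import ring lra.
Import Order.TTheory GRing.Theory Num.Theory.
Import numFieldNormedType.Exports.
Local Open Scope classical_set_scope.
Local Open Scope ring_scope.

(* The class of orthounimodal f with 0 <= f <= M is convex, and on a grid of
   (k+1)^d cells such an f lies between its values at the upper and the lower
   corner of each cell.  The diagonal differences of the corner values sum to at
   most M d (k+1)^(d-1), so the cellwise step functions bracket f within O(1/k) in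
   L^1, and also in the L^1 norm weighted by phi_j^+ or phi_j^-, uniformly in f.
   Hence the sample moments of all f at once are controlled by the finitely many
   averages of phi_j^{+-} 1_cell / g, for which a strong law holds.  Brackets also
   take care of the measurability of f: they pin down the value of the integral
   and make it affine in f although f need not be Borel.

   The values converge because the program is stable under uniformly small
   perturbations of its moments: a feasible point is repaired by mixing in a little
   of the Slater point (for the inequalities) and of points realising the equality
   levels shifted along +-e_k (for the equalities); the weights of the latter solve
   a diagonally dominant linear system.  The deviation of the averages is
   measurable, so it bounds the minimal majorants. *)

(** Two obstacles shape the proof. The class of f is uncountable and its members need not be Borel,
    so the optimal values may fail to be measurable; every estimate is therefore deterministic until
    only finitely many cell averages remain. And the weights [phi j] are unbounded, while the
    diagonal count controls only unweighted gaps: splitting a weight at a level t, psi <= t +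
    t^(-dl) psi^(1+dl), leaves the bounded part to the count and a tail that is small uniformly in
    f. This is one use of the moment of order 1 + delta; the other is the rate in the law of large
    numbers. The exponent is lowered to [Num.min delta 1] because the second moment of a truncated
    variable is controlled by its moment of order 1 + dl through a factor N^(1-dl), which calls for
    dl <= 1. As L = f / g, the density cancels from the population moments and survives in the
    sample averages only, as the factor 1 / g, kept bounded by the positive infimum of g. The
    perturbation argument takes its Slater data from the population program alone, so its constants
    do not depend on the sample. *)

(** * Stability of convex programs *)

Section optimisation.
Context {R : realType} {V : lmodType R}.
Implicit Types (K : set V) (c : V -> R).

(** Finite combinations of any length rather than binary ones, because the repair of a feasible
    point mixes [2 + 2 * q] points at once. *)
Definition convex_set K := forall (I : finType) (w : I -> R) (v : I -> V),
  (forall i, 0 <= w i) -> \sum_i w i = 1 -> (forall i, K (v i)) ->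
  K (\sum_i w i *: v i).

Definition affine_on K c := forall (I : finType) (w : I -> R) (v : I -> V),
  (forall i, 0 <= w i) -> \sum_i w i = 1 -> (forall i, K (v i)) ->
  c (\sum_i w i *: v i) = \sum_i w i * c (v i).

End optimisation.

(** The diagonal [2 * r] beats the row sums of [E], which are at most [q%:R * k <= r], so the matrix
    expands the sup norm by a factor at least [r]. This gives injectivity, hence solvability, and
    also the bound on the solution. *)
Lemma diag_perturbation_solvable {R : realType} {q : nat} (E : 'M[R]_q)
    (rho : 'cV[R]_q) (r k e : R) :
  0 < r -> q%:R * k <= r -> (forall i j, `|E i j| <= k) ->
  (forall i, `|rho i 0| <= e) -> e <= r ->
  exists2 s : 'cV[R]_q, ((2 * r)%:M + E) *m s = rho & forall i, `|s i 0| <= 1.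
Proof.
move=> r0 qk Ek rhoe er.
have bound (s : 'cV[R]_q) i : (2 * r) * `|s i 0| <=
    `|(((2 * r)%:M + E) *m s) i 0| + q%:R * k * \big[Num.max/0]_j `|s j 0|.
  set S := \big[Num.max/0]_j _.
  have -> : (((2 * r)%:M + E) *m s) i 0 =
      (2 * r) * s i 0 + \sum_j E i j * s j 0.
    by rewrite mulmxDl mul_scalar_mx !mxE.
  have sE : `|\sum_j E i j * s j 0| <= q%:R * k * S.
    apply: (le_trans (ler_norm_sum _ _ _)).
    have -> : q%:R * k * S = \sum_(j < q) (k * S).
      by rewrite sumr_const card_ord -[RHS]mulr_natl mulrA.
    apply: ler_sum => j _; rewrite normrM; apply: ler_pM => //.
    by rewrite /S; apply: le_bigmax.
  have -> : (2 * r) * `|s i 0| =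
      `|(2 * r) * s i 0 + \sum_j E i j * s j 0 - \sum_j E i j * s j 0|.
    by rewrite addrK normrM gtr0_norm// mulr_gt0.
  by apply: (le_trans (ler_normB _ _)); rewrite lerD2l.
have bound' (s : 'cV[R]_q) (x : R) : 0 <= x ->
    (forall i, `|(((2 * r)%:M + E) *m s) i 0| <= x) ->
    r * \big[Num.max/0]_j `|s j 0| <= x.
  move=> x0 sx; set S := \big[Num.max/0]_j _.
  have S0 : 0 <= S by rewrite /S; apply: bigmax_ge_id.
  suff : (2 * r) * S <= x + r * S by lra.
  have : S <= (x + r * S) / (2 * r).
    apply: bigmax_le => [|i _].
      by rewrite divr_ge0// ?addr_ge0// mulr_ge0// ltW.
    rewrite ler_pdivlMr ?mulr_gt0// mulrC.
    apply: (le_trans (bound s i)); apply: lerD => //.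
    by rewrite -/S; apply: ler_wpM2r.
  by rewrite ler_pdivlMr ?mulr_gt0// mulrC.
have Aunit : ((2 * r)%:M + E) \in unitmx.
  (* [kermx] is the left kernel, so injectivity on columns is read off the transpose. *)
  rewrite -unitmx_tr -row_free_unit -kermx_eq0.
  apply/eqP/row_matrixP => i; rewrite row0; set v := row i _.
    have vA : v *m ((2 * r)%:M + E)^T = 0 by rewrite /v -row_mul mulmx_ker row0.
    have Av : ((2 * r)%:M + E) *m v^T = 0.
      by rewrite -[LHS]trmxK trmx_mul trmxK vA trmx0.
    have h : r * \big[Num.max/0]_j `|v^T j 0| <= 0.
      by apply: (bound' v^T) => // j; rewrite Av mxE normr0.
    apply/rowP => j; rewrite [RHS]mxE; apply/eqP; rewrite -normr_le0.
    have : r * `|v 0 j| <= 0.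
      apply: le_trans h; rewrite ler_pM2l//.
      have := le_bigmax 0 (fun j => `|v^T j 0|) j; rewrite mxE//.
  by rewrite pmulr_rle0.
exists (invmx ((2 * r)%:M + E) *m rho); first by rewrite mulKVmx.
move=> i; have e0 : 0 <= e by apply: le_trans (rhoe i).
have := bound' (invmx ((2 * r)%:M + E) *m rho) e e0.
rewrite mulKVmx// => /(_ rhoe) h.
have : r * `|(invmx ((2 * r)%:M + E) *m rho) i 0| <= r.
  apply: le_trans er; apply: le_trans h; rewrite ler_pM2l//.
  exact: (le_bigmax 0 (fun j => `|(invmx ((2 * r)%:M + E) *m rho) j 0|) i).
by rewrite -[leRHS]mulr1 ler_pM2l.
Qed.

Section feasible_transfer.
Context {R : realType} {V : lmodType R}.
Variables (K : set V) (l m : nat) (mu : nat -> R).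
Hypothesis ml : (m <= l)%N.
Hypothesis Kconv : convex_set K.

Definition satisfies (c : nat -> V -> R) (v : V) :=
  (forall j, (1 <= j <= m)%N -> c j v <= mu j) /\
  (forall j, (m < j <= l)%N -> c j v = mu j).

Definition uniformly_close (eta : R) (c c' : nat -> V -> R) :=
  forall j v, (j <= l)%N -> K v -> `|c' j v - c j v| <= eta.

Variables (c : nat -> V -> R) (B : R).
Hypothesis cB : forall j v, (j <= l)%N -> K v -> `|c j v| <= B.
Variables (v0 : V) (vp vm : 'I_(l - m) -> V) (r sg : R).
Hypotheses (r0 : 0 < r) (sg0 : 0 < sg) (K0 : K v0).
Hypotheses (Kp : forall k, K (vp k)) (Km : forall k, K (vm k)).
Hypothesis slack : forall j, (1 <= j <= m)%N -> c j v0 <= mu j - sg.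
Hypothesis c0E : forall j, (m < j <= l)%N -> c j v0 = mu j.
Hypothesis cpE : forall k i : 'I_(l - m),
  c (m + k.+1)%N (vp i) = mu (m + k.+1)%N + r * (k == i)%:R.
Hypothesis cmE : forall k i : 'I_(l - m),
  c (m + k.+1)%N (vm i) = mu (m + k.+1)%N - r * (k == i)%:R.

Let q := (l - m)%N.

Let index := (bool + ('I_q + 'I_q))%type.

(* The correction s of the weights is chosen to restore the equality constraints,
   the weight t of the Slater point v0 absorbs the errors in the inequalities. *)
Let weight (t u : R) (s : 'cV[R]_q) (i : index) : R :=
  match i with
  | inl true => 1 - t - 2 * q%:R * u
  | inl false => t
  | inr (inl k) => u * (1 + s k 0)
  | inr (inr k) => u * (1 - s k 0)
  end.

Let point (v : V) (i : index) : V :=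
  match i with
  | inl true => v
  | inl false => v0
  | inr (inl k) => vp k
  | inr (inr k) => vm k
  end.

Let big_index (A : zmodType) (F : index -> A) :
  \sum_i F i = F (inl true) + F (inl false) +
    (\sum_k F (inr (inl k)) + \sum_k F (inr (inr k))).
Proof. by rewrite big_sumType /= big_bool /= big_sumType. Qed.

Let weight_ge0 (t u : R) (s : 'cV[R]_q) i : 0 <= t -> 0 <= u -> t + 2 * q%:R * u <= 1 ->
  (forall k, `|s k 0| <= 1) -> 0 <= weight t u s i.
Proof.
move=> t0 u0 tu s1; case: i => [[]|[k|k]] //=; first by rewrite subr_ge0 lerBrDr addrC.
  by rewrite mulr_ge0//; have := s1 k; rewrite ler_norml => /andP[? ?]; lra.
by rewrite mulr_ge0//; have := s1 k; rewrite ler_norml => /andP[? ?]; lra.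
Qed.

Let weight_sum (t u : R) (s : 'cV[R]_q) : \sum_i weight t u s i = 1.
Proof.
rewrite big_index /= -big_split /=.
rewrite (eq_bigr (fun=> 2 * u)); last by move=> k _; lra.
rewrite sumr_const card_ord -mulr_natl; ring.
Qed.

(** [c] carries the Slater data; [v] is feasible for [c'] and gets repaired into a point feasible
    for [c'']. Allowing both to deviate from [c] lets one lemma compare the optimal values in either
    direction. *)
Lemma satisfies_transfer (e : R) : 0 < e -> exists2 eta : R, 0 < eta &
  forall c' c'' : nat -> V -> R,
  (forall j, (j <= l)%N -> affine_on K (c'' j)) ->
  uniformly_close eta c c' -> uniformly_close eta c c'' ->
  forall v, K v -> satisfies c' v ->
  exists v', [/\ K v', satisfies c'' v' & c' 0%N v - e <= c'' 0%N v'].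
Proof.
move=> e0.
pose B1 : R := `|B| + 1 + \sum_(j < l.+1) `|mu j|.
have muB j : (j <= l)%N -> `|mu j| <= \sum_(j < l.+1) `|mu j|.
  rewrite -ltnS => jl; rewrite (bigD1 (Ordinal jl))//= lerDl.
  by apply: sumr_ge0.
have B10 : 0 < B1.
  rewrite /B1 -addrA ltr_wpDl// ltr_pwDl//; apply: sumr_ge0 => //.
pose Q : R := 2 * q%:R + 1.
have Q0 : 0 < Q by rewrite /Q ltr_wpDl// mulr_ge0.
(* The constants are chosen in the order [t], [u], [eta]. [t] is small against [e], the price of
   mixing in [v0]; [u] is small against [t * sg], so that the shifted points use up at most half of
   the slack gained from [v0]. *)
pose t := Num.min (1 / 2) (e / (8 * B1)).
have t0 : 0 < t by rewrite lt_min divr_gt0//= divr_gt0// mulr_gt0.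
have t2 : t <= 1 / 2 by rewrite ge_min lexx.
have tB : t * B1 <= e / 8.
  have : t <= e / (8 * B1) by rewrite ge_min lexx orbT.
  by rewrite ler_pdivlMr ?mulr_gt0// => ?; lra.
pose u := Num.min (1 / (2 * Q)) (Num.min (e / (8 * B1 * Q)) (t * sg / (2 * B1 * Q))).
have u0 : 0 < u.
  by rewrite !lt_min; apply/and3P; split; rewrite ?divr_gt0 ?mulr_gt0.
have uQ : u * Q <= 1 / 2.
  have : u <= 1 / (2 * Q) by rewrite ge_min lexx.
  by rewrite ler_pdivlMr ?mulr_gt0// => ?; lra.
have uB : u * Q * B1 <= e / 8.
  have : u <= e / (8 * B1 * Q) by rewrite !ge_min lexx !orbT.
  by rewrite ler_pdivlMr ?mulr_gt0// => ?; lra.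
have us : u * Q * B1 <= t * sg / 2.
  have : u <= t * sg / (2 * B1 * Q) by rewrite !ge_min lexx !orbT.
  by rewrite ler_pdivlMr ?mulr_gt0// => ?; lra.
(* The bound 1 makes [B1] valid for [c'']; [t * sg / 6] pays for three errors [eta] out of the other
   half of the slack; [r / Q] secures diagonal dominance; [2 + Q] counts the residuals in [rho],
   namely 2 from [v], 1 from [v0] and [2 * q] from the shifted points. *)
pose eta := Num.min (Num.min 1 (e / 8)) (Num.min (t * sg / 6)
   (Num.min (r / Q) (u * r / (2 + Q)))).
have eta0 : 0 < eta.
  by rewrite !lt_min ltr01 !divr_gt0 ?mulr_gt0// addr_gt0.
have eta1 : eta <= 1 by rewrite !ge_min lexx.
have etae : eta <= e / 8 by rewrite !ge_min lexx !orbT.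
have etas : eta <= t * sg / 6 by rewrite !ge_min lexx !orbT.
have etar : eta * Q <= r.
  have : eta <= r / Q by rewrite !ge_min lexx !orbT.
  by rewrite ler_pdivlMr.
have etau : eta * (2 + Q) <= u * r.
  have : eta <= u * r / (2 + Q) by rewrite !ge_min lexx !orbT.
  by rewrite ler_pdivlMr// addr_gt0.
have qu : q%:R * u * 2 <= u * Q by rewrite /Q; lra.
have tu1 : t + 2 * q%:R * u <= 1 by lra.
exists eta => // c' c'' c''aff cc' cc'' v Kv [vle veq].
have c''B j v1 : (j <= l)%N -> K v1 -> `|c'' j v1| <= B1.
  move=> jl Kv1; have := cB _ _ jl Kv1; have := cc'' _ _ jl Kv1.
  have : 0 <= \sum_(j < l.+1) `|mu j| by apply: sumr_ge0.
  have := ler_norm B; rewrite /B1 => H1 H2 H3 H4.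
  have -> : c'' j v1 = (c'' j v1 - c j v1) + c j v1 by rewrite subrK.
  by apply: (le_trans (ler_normD _ _)); lra.
have c''muB j v1 : (j <= l)%N -> K v1 -> `|c'' j v1 - mu j| <= B1.
  move=> jl Kv1; have := cB _ _ jl Kv1; have := cc'' _ _ jl Kv1.
  have := muB _ jl; have := ler_norm B; rewrite /B1 => H1 H2 H3 H4.
  have -> : c'' j v1 - mu j = (c'' j v1 - c j v1) + c j v1 - mu j by rewrite subrK.
  apply: (le_trans (ler_normB _ _)).
  have := ler_normD (c'' j v1 - c j v1) (c j v1).
  by move=> ?; lra.
have eqidx (k : 'I_q) : (m < m + k.+1 <= l)%N.
  by rewrite -addSnnS leq_addr/= addSnnS -leq_subRL// ltn_ord.
have eqle (k : 'I_q) : (m + k.+1 <= l)%N by have /andP[] := eqidx k.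
pose dev (k : 'I_q) (v1 : V) := c'' (m + k.+1)%N v1 - mu (m + k.+1)%N.
pose Ep : 'M[R]_q := \matrix_(k, i) (dev k (vp i) - r * (k == i)%:R).
pose Em : 'M[R]_q := \matrix_(k, i) (dev k (vm i) + r * (k == i)%:R).
have EpB k i : `|Ep k i| <= eta.
  rewrite mxE /dev; apply: le_trans (cc'' _ _ (eqle k) (Kp i)).
  by rewrite cpE le_eqVlt; apply/orP; left; apply/eqP; congr `|_|; ring.
have EmB k i : `|Em k i| <= eta.
  rewrite mxE /dev; apply: le_trans (cc'' _ _ (eqle k) (Km i)).
  by rewrite cmE le_eqVlt; apply/orP; left; apply/eqP; congr `|_|; ring.
(* In the k-th equality residual of the mixture the shifted points contribute 2 u r s_k + u ((Ep -
   Em) s)_k + u sum_i (Ep + Em)_(k,i). Setting the residual to zero gives a linear system for [s]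
   with right-hand side [rho]. *)
pose rho : 'cV[R]_q := \col_k (- ((1 - t - 2 * q%:R * u) * dev k v + t * dev k v0
   + u * \sum_i (Ep k i + Em k i))).
have [s sE s1] : exists2 s : 'cV[R]_q,
    ((2 * (u * r))%:M + u *: (Ep - Em)) *m s = rho & forall i, `|s i 0| <= 1.
  apply: (@diag_perturbation_solvable _ _ _ _ _ (2 * u * eta) (eta * (2 + Q))) => //.
  - by rewrite mulr_gt0.
  - have : u * (eta * Q) <= u * r by rewrite ler_pM2l.
    have : 0 < u * eta by rewrite mulr_gt0.
    by rewrite /Q => H1 H2; lra.
  - move=> k i; rewrite !mxE normrM gtr0_norm//.
    rewrite -[X in _ <= X * _]/(2 * u) [2 * u]mulrC -mulrA ler_pM2l//.
    have := EpB k i; have := EmB k i; rewrite !mxE => H1 H2.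
    by apply: (le_trans (ler_normB _ _)); lra.
  - move=> k; rewrite mxE normrN.
    have dv : `|dev k v| <= 2 * eta.
      rewrite /dev -(veq _ (eqidx k)).
      have := cc' _ _ (eqle k) Kv; have := cc'' _ _ (eqle k) Kv.
      set x := c _ _ => H1 H2.
      have -> : c'' (m + k.+1)%N v - c' (m + k.+1)%N v =
        (c'' (m + k.+1)%N v - x) - (c' (m + k.+1)%N v - x) by lra.
      by apply: (le_trans (ler_normB _ _)); lra.
    have dv0 : `|dev k v0| <= eta.
      by rewrite /dev -(c0E _ (eqidx k)); exact: cc''.
    have sE : `|\sum_i (Ep k i + Em k i)| <= q%:R * (2 * eta).
      apply: (le_trans (ler_norm_sum _ _ _)).
      have -> : q%:R * (2 * eta) = \sum_(i < q) (2 * eta).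
        by rewrite sumr_const card_ord -[RHS]mulr_natl.
      apply: ler_sum => i _; apply: (le_trans (ler_normD _ _)).
      by have := EpB k i; have := EmB k i; lra.
    apply: (le_trans (ler_normD _ _)).
    have : `|u * \sum_i (Ep k i + Em k i)| <= q%:R * (2 * eta).
      rewrite normrM gtr0_norm//; apply: le_trans sE; rewrite ler_piMl//.
      have : 0 <= u * (2 * q%:R) by rewrite mulr_ge0 ?mulr_ge0// ltW.
      by move: uQ; rewrite /Q => H1 H2; lra.
    have : `|(1 - t - 2 * q%:R * u) * dev k v + t * dev k v0| <= 3 * eta.
      apply: (le_trans (ler_normD _ _)); rewrite !normrM.
      have : `|1 - t - 2 * q%:R * u| <= 1.
        rewrite ler_norml; apply/andP; split.
          by lra.
        have : 0 <= 2 * q%:R * u by rewrite !mulr_ge0// ltW.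
        by lra.
      have : `|t| <= 1 by rewrite gtr0_norm//; lra.
      move=> H1 H2.
      have : `|1 - t - 2 * q%:R * u| * `|dev k v| <= 1 * (2 * eta) by apply: ler_pM.
      have : `|t| * `|dev k v0| <= 1 * eta by apply: ler_pM.
      by lra.
    by rewrite /Q => H1 H2; lra.
pose v' := \sum_i weight t u s i *: point v i.
have Kpt i : K (point v i) by case: i => [[]|[]] /=.
have w0 i : 0 <= weight t u s i by apply: weight_ge0 => //; exact: ltW.
have c''v' j : (j <= l)%N -> c'' j v' = \sum_i weight t u s i * c'' j (point v i).
  by move=> jl; rewrite /v' (c''aff j jl)//; exact: weight_sum.
have rest (x : V -> R) (b : R) : (forall v1, K v1 -> `|x v1| <= b) ->
    `|\sum_k u * (1 + s k 0) * x (vp k) + \sum_k u * (1 - s k 0) * x (vm k)|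
    <= u * Q * b.
  move=> xb; have b0 : 0 <= b by apply: le_trans (xb _ K0).
  rewrite -big_split/=; apply: (le_trans (ler_norm_sum _ _ _)).
  apply: (@le_trans _ _ (\sum_(k < q) (2 * u * b))).
    apply: ler_sum => k _; apply: (le_trans (ler_normD _ _)).
    have /= wp := w0 (inr (inl k)); have /= wm := w0 (inr (inr k)).
    rewrite normrM [in X in _ + X]normrM (ger0_norm wp) (ger0_norm wm).
    have H1 := ler_wpM2l wp (xb _ (Kp k)).
    have H2 := ler_wpM2l wm (xb _ (Km k)).
    by apply: (le_trans (lerD H1 H2)); lra.
  rewrite sumr_const card_ord -[leLHS]mulr_natl.
  have : 0 <= u * b by rewrite mulr_ge0// ltW.
  by rewrite /Q => ?; lra.
exists v'; split.
- by apply: Kconv => //; exact: weight_sum.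
- split.
  + move=> j jm; have jl : (j <= l)%N by case/andP: jm => _ /leq_trans; apply.
    rewrite -subr_le0.
    have -> : c'' j v' - mu j = \sum_i weight t u s i * (c'' j (point v i) - mu j).
      under eq_bigr do rewrite mulrBr.
      by rewrite sumrB -mulr_suml weight_sum mul1r c''v'.
    rewrite big_index /=.
    have := rest (fun v1 => c'' j v1 - mu j) B1 (fun v1 => c''muB j v1 jl).
    move=> /(le_trans (ler_norm _)) H1.
    have H2 : c'' j v - mu j <= 2 * eta.
      have := ler_norm (c'' j v - c j v).
      have := cc'' _ _ jl Kv; have := vle _ jm.
      have := cc' _ _ jl Kv; rewrite ler_norml => /andP[H3 H4] H5 H6 H7.
      by lra.
    have H3 : c'' j v0 - mu j <= - sg + eta.
      have := ler_norm (c'' j v0 - c j v0).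
      by have := cc'' _ _ jl K0; have := slack _ jm; lra.
    have /= H4 := w0 (inl true).
    have H5 := ler_wpM2l (w0 (inl true)) H2.
    have H6 := ler_wpM2l (w0 (inl false)) H3.
    have H7 : (1 - t - 2 * q%:R * u) * (2 * eta) <= 1 * (2 * eta).
      apply: ler_wpM2r; first by rewrite mulr_ge0// ltW.
      have : 0 <= 2 * q%:R * u by rewrite !mulr_ge0// ltW.
      by lra.
    have H8 : t * eta <= 1 * eta by rewrite ler_wpM2r; lra.
    move: H5 H6; rewrite /= mulrDr => H5 H6; lra.
  + move=> j jm.
    have kq : (j - m.+1 < q)%N.
      by case/andP: jm => mj jl; rewrite ltn_subLR// addSn ltnS /q subnKC.
    pose k : 'I_q := Ordinal kq.
    have jE : j = (m + k.+1)%N by case/andP: jm => mj _; rewrite /= addnS -addSn subnKC.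
    have jl := eqle k; rewrite jE; apply/eqP; rewrite -subr_eq0; apply/eqP.
    have -> : c'' (m + k.+1)%N v' - mu (m + k.+1)%N =
        \sum_i weight t u s i * dev k (point v i).
      under eq_bigr do rewrite /dev mulrBr.
      by rewrite sumrB -mulr_suml weight_sum mul1r c''v'.
    rewrite big_index /= -big_split /=.
    have /matrixP/(_ k 0) := sE.
    rewrite mulmxDl mul_scalar_mx !mxE => sEk.
    have -> : \sum_i (u * (1 + s i 0) * dev k (vp i) + u * (1 - s i 0) * dev k (vm i))
        = 2 * (u * r) * s k 0 + \sum_j0 (u *: (Ep - Em)) k j0 * s j0 0 +
          u * \sum_i (Ep k i + Em k i).
      have -> : 2 * (u * r) * s k 0 = \sum_i (2 * (u * r) * s i 0 * (k == i)%:R).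
        rewrite (bigD1 k)//= eqxx mulr1 big1 ?addr0// => i ik.
        by rewrite eq_sym (negbTE ik) mulr0.
      rewrite mulr_sumr -!big_split/=; apply: eq_bigr => i _; rewrite !mxE; ring.
    by rewrite sEk; ring.
- rewrite c''v'// big_index /=.
  have := rest (fun v1 => c'' 0%N v1) B1 (fun v1 => c''B 0%N v1 (leq0n _)).
  rewrite ler_norml => /andP[H1 _].
  have := c''B _ _ (leq0n _) K0; rewrite ler_norml => /andP[H2 _].
  have H3 := ler_wpM2l (ltW t0) H2.
  have H4 : - (t * B1 + u * Q * B1) <= - ((t + 2 * q%:R * u) * c'' 0%N v).
    rewrite lerN2; apply: (le_trans (ler_norm _)); rewrite normrM.
    have H0 : 0 <= t + 2 * q%:R * u.
      by rewrite addr_ge0 ?mulr_ge0// ltW.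
    rewrite (ger0_norm H0).
    apply: (le_trans (ler_wpM2l H0 (c''B _ _ (leq0n _) Kv))).
    rewrite -mulrDl ler_pM2r//; lra.
  have := cc' _ _ (leq0n _) Kv; rewrite ler_norml => /andP[_ H5].
  have := cc'' _ _ (leq0n _) Kv; rewrite ler_norml => /andP[H6 _].
  move: H1 H3 H4 H5 H6; set S := \sum_k _ + _; lra.
Qed.

End feasible_transfer.

(** * A strong law of large numbers *)

Section pairwise_iid.
Local Open Scope ereal_scope.
Context {R : realType} {dO dT : measure_display} {Omega : measurableType dO}
  {T : measurableType dT} {P : probability Omega R}.
Variable X : nat -> {RV P >-> T}.
Hypothesis X_ident : forall i (A : set T), measurable A ->
  P (X i @^-1` A) = P (X 0%N @^-1` A).
Hypothesis X_pindep : forall i j (A B : set T), i != j -> measurable A ->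
  measurable B ->
  P (X i @^-1` A `&` X j @^-1` B) = P (X i @^-1` A) * P (X j @^-1` B).

Lemma ident_integral (F : T -> \bar R) i : measurable_fun setT F ->
  (forall x, 0 <= F x) -> \int[P]_w F (X i w) = \int[P]_w F (X 0%N w).
Proof.
move=> mF F0.
rewrite -[LHS](ge0_integral_distribution (X i) mF F0).
rewrite -[RHS](ge0_integral_distribution (X 0%N) mF F0).
by apply: eq_measure_integral => A mA _; exact: X_ident.
Qed.

(** Independence identifies the joint law of [X i] and [X j] with the product of their laws, as the
    two agree on rectangles; Tonelli does the rest. *)
Lemma pindep_integral (F G : T -> R) i j : i != j ->
  measurable_fun setT F -> measurable_fun setT G ->
  (forall x, (0 <= F x)%R) -> (forall x, (0 <= G x)%R) ->
  \int[P]_w (F (X i w) * G (X j w))%:E =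
  \int[P]_w (F (X i w))%:E * \int[P]_w (G (X j w))%:E.
Proof.
move=> ij mF mG F0 G0.
have mXY : measurable_fun setT (fun w => (X i w, X j w)).
  by apply/measurable_fun_pairP; split => /=; exact: measurable_funPT.
pose XY : {mfun Omega >-> (T * T)%type} := HB.pack (fun w => (X i w, X j w))
  (isMeasurableFun.Build _ _ _ _ _ mXY).
have mf : measurable_fun setT (fun z : T * T => (F z.1 * G z.2)%:E).
  apply/measurable_EFinP; apply: measurable_funM.
    by apply: measurableT_comp => //; exact: measurable_fst.
  by apply: measurableT_comp => //; exact: measurable_snd.
have f0 (z : T * T) : 0 <= (F z.1 * G z.2)%:E by rewrite lee_fin mulr_ge0.
transitivity (\int[distribution P XY]_z (F z.1 * G z.2)%:E).
  by rewrite ge0_integral_distribution.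
transitivity (\int[distribution P (X i) \x distribution P (X j)]_z (F z.1 * G z.2)%:E).
  apply: eq_measure_integral => A mA _.
  apply/esym/product_measure_unique => // A1 A2 mA1 mA2.
  by rewrite /= /pushforward -X_pindep.
rewrite fubini_tonelli1//= /fubini_F/=.
transitivity (\int[distribution P (X i)]_x
    ((F x)%:E * \int[distribution P (X j)]_y (G y)%:E)).
  apply: eq_integral => x _.
  under eq_integral do rewrite EFinM.
  rewrite ge0_integralZl_EFin//; first by move=> y _; rewrite lee_fin.
  exact/measurable_EFinP.
have mFe : measurable_fun setT (EFin \o F) by exact/measurable_EFinP.
have mGe : measurable_fun setT (EFin \o G) by exact/measurable_EFinP.
have F0e x : 0 <= (EFin \o F) x by rewrite lee_fin.
have G0e x : 0 <= (EFin \o G) x by rewrite lee_fin.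
rewrite (ge0_integralZr _ measurableT mFe)//; last by apply: integral_ge0 => y _; exact: G0e.
rewrite -(ge0_integral_distribution (X i) mFe F0e).
by rewrite -(ge0_integral_distribution (X j) mGe G0e).
Qed.

Lemma iid_variance_sum (F : T -> R) (m a : R) n :
  measurable_fun setT F -> (forall x, (0 <= F x)%R) ->
  \int[P]_w (F (X 0%N w))%:E = m%:E ->
  \int[P]_w (F (X 0%N w) ^+ 2)%:E = a%:E ->
  \int[P]_w ((\sum_(i < n) F (X i w) - n%:R * m) ^+ 2)%:E =
  (n%:R * (a - m ^+ 2))%:E.
Proof.
move=> mF F0 Fm Fa.
have mFX i : measurable_fun setT (fun w => F (X i w)).
  by apply: measurableT_comp => //; exact: measurable_funPT.
have FX i : \int[P]_w (F (X i w))%:E = m%:E.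
  rewrite -Fm; apply: (ident_integral (EFin \o F)); first exact/measurable_EFinP.
  by move=> x; rewrite lee_fin.
have FFX (i j : 'I_n) : \int[P]_w (F (X i w) * F (X j w))%:E =
    (m ^+ 2 + (i == j)%:R * (a - m ^+ 2))%:E.
  have [->|ij] := eqVneq i j.
    rewrite mul1r addrC subrK -Fa.
    apply: (ident_integral (fun x => (F x ^+ 2)%:E)).
      by apply/measurable_EFinP; exact: measurable_funX.
    by move=> x; rewrite lee_fin sqr_ge0.
  by rewrite mul0r addr0 (pindep_integral _ _ _ _ ij)// !FX.
have m0 : (0 <= m)%R.
  by rewrite -lee_fin -Fm; apply: integral_ge0 => w _; rewrite lee_fin.
have mS : measurable_fun setT (fun w => \sum_(i < n) F (X i w))%R.
  by apply: measurable_sum.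
have S0 w : (0 <= \sum_(i < n) F (X i w))%R by apply: sumr_ge0.
have ES : \int[P]_w (\sum_(i < n) F (X i w))%:E = (n%:R * m)%:E.
  under eq_integral do rewrite -sumEFin.
  rewrite ge0_integral_sum//.
  - by under eq_bigr do rewrite FX; rewrite sumEFin sumr_const card_ord mulr_natl.
  - by move=> i; exact/measurable_EFinP.
  - by move=> i w _; rewrite lee_fin.
have ES2 : \int[P]_w ((\sum_(i < n) F (X i w)) ^+ 2)%:E =
    (n%:R ^+ 2 * m ^+ 2 + n%:R * (a - m ^+ 2))%:E.
  under eq_integral => w _.
    rewrite expr2 mulr_suml -sumEFin.
    under eq_bigr do rewrite mulr_sumr -sumEFin.
    over.
  rewrite ge0_integral_sum//; last 2 first.
  - move=> i; apply: emeasurable_sum => j; apply/measurable_EFinP.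
    exact: measurable_funM.
  - by move=> i w _; apply: sume_ge0 => j _; rewrite lee_fin mulr_ge0.
  under eq_bigr => i _.
    rewrite ge0_integral_sum//; last 2 first.
    - by move=> j; apply/measurable_EFinP; exact: measurable_funM.
    - by move=> j w _; rewrite lee_fin mulr_ge0.
    under eq_bigr do rewrite FFX.
    rewrite sumEFin big_split/= sumr_const card_ord (bigD1 i)//= eqxx mul1r.
    rewrite big1 ?addr0; last by move=> j; rewrite eq_sym => /negbTE ->; rewrite mul0r.
    over.
  rewrite sumEFin sumr_const card_ord; congr EFin.
  by ring.
(* The cross term of the square is moved to the left, so that every integrand is nonnegative and
   additivity of the integral asks for no integrability. *)
have : \int[P]_w (((\sum_(i < n) F (X i w) - n%:R * m) ^+ 2)%:E +
      (2 * (n%:R * m) * \sum_(i < n) F (X i w))%:E) =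
    \int[P]_w (((\sum_(i < n) F (X i w)) ^+ 2)%:E + ((n%:R * m) ^+ 2)%:E).
  by apply: eq_integral => w _; rewrite -!EFinD; congr EFin; ring.
have mD : measurable_fun setT (fun w => (\sum_(i < n) F (X i w) - n%:R * m)%R).
  exact: measurable_funB.
rewrite ge0_integralD//=; last 4 first.
- by move=> w _; rewrite lee_fin sqr_ge0.
- by apply/measurable_EFinP; exact: measurable_funX.
- by move=> w _; rewrite lee_fin !mulr_ge0.
- by apply/measurable_EFinP; exact: measurable_funM.
rewrite [in RHS]ge0_integralD//=; last 3 first.
- by move=> w _; rewrite lee_fin sqr_ge0.
- by apply/measurable_EFinP; exact: measurable_funX.
- by move=> w _; rewrite lee_fin sqr_ge0.
under [X in _ + X = _]eq_integral do rewrite EFinM.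
rewrite ge0_integralZl_EFin//=; last 3 first.
- by move=> w _; rewrite lee_fin.
- exact/measurable_EFinP.
- by rewrite !mulr_ge0.
rewrite ES ES2 integral_cst//= (_ : P setT = 1) ?mule1; last exact: probability_setT.
set I := \int[P]_w _; have : 0 <= I.
  by apply: integral_ge0 => w _; rewrite lee_fin sqr_ge0.
case: I => [I _| |] //=; rewrite -!EFinD -?EFinM => -[] H; congr EFin.
by move: H; lra.
Qed.

End pairwise_iid.

(** With y = min(x, N), y^2 = y^(1+dl) y^(1-dl), and the second factor is at most N^(1-dl) because
    dl <= 1. *)
Lemma minr_sqr_le_powR {R : realType} (x N dl : R) : 0 <= x -> 0 < N ->
  0 < dl <= 1 -> Num.min x N ^+ 2 * N `^ dl <= x `^ (1 + dl) * N.
Proof.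
move=> x0 N0 /andP[dl0 dl1]; set y := Num.min x N.
have [->|y_neq0] := eqVneq y 0.
  by rewrite expr0n mul0r mulr_ge0 ?powR_ge0// ltW.
have y0 : 0 < y by rewrite lt_neqAle eq_sym y_neq0 le_min x0 ltW.
have yx : y <= x by rewrite ge_min lexx.
have yN : y <= N by rewrite ge_min lexx orbT.
have -> : y ^+ 2 = y `^ (1 + dl) * y `^ (1 - dl).
  rewrite -powRD; last by rewrite y_neq0 implybT.
  by rewrite addrACA subrr addr0 -[1 + 1]/(2%:R) powR_mulrn// ltW.
have {2}-> : N = N `^ (1 - dl) * N `^ dl.
  by rewrite -powRD ?subrK ?powRr1// ?ltW// gt_eqF// implybT.
rewrite mulrA ler_wpM2r ?powR_ge0//.
rewrite ler_pM ?powR_ge0//; apply: ge0_ler_powR; rewrite ?nnegrE// ?subr_ge0// ltW//.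
by rewrite addr_gt0.
Qed.

(** The excess vanishes unless x > N, and then x N^dl <= x^(1+dl). Besides bounding the truncation
    error, this splits a weight at a level: x <= N + N^(-dl) x^(1+dl). *)
Lemma subr_minr_le_powR {R : realType} (x N dl : R) : 0 <= x -> 0 < N ->
  0 < dl -> (x - Num.min x N) * N `^ dl <= x `^ (1 + dl).
Proof.
move=> x0 N0 dl0; have [xN|Nx] := leP x N; first by rewrite subrr mul0r powR_ge0.
have x_gt0 : 0 < x by exact: lt_trans Nx.
rewrite powRD; last by rewrite (gt_eqF x_gt0) implybT.
rewrite powRr1//; apply: ler_pM; rewrite ?powR_ge0 ?subr_ge0 ?(ltW Nx)//.
  by rewrite gerBl ltW.
by apply: ge0_ler_powR; rewrite ?nnegrE// ?(ltW dl0) ?(ltW Nx) ?(ltW N0).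
Qed.

Section mean_deviation.
Local Open Scope ereal_scope.
Context {R : realType} {dO dT : measure_display} {Omega : measurableType dO}
  {T : measurableType dT} {P : probability Omega R}.
Variable X : nat -> {RV P >-> T}.
Hypothesis X_ident : forall i (A : set T), measurable A ->
  P (X i @^-1` A) = P (X 0%N @^-1` A).
Hypothesis X_pindep : forall i j (A B : set T), i != j -> measurable A ->
  measurable B ->
  P (X i @^-1` A `&` X j @^-1` B) = P (X i @^-1` A) * P (X j @^-1` B).
Variables (h : T -> R) (dl mean C : R).
Hypotheses (mh : measurable_fun setT h) (h0 : forall x, (0 <= h x)%R).
Hypothesis dl01 : (0 < dl <= 1)%R.
Hypothesis h_mean : \int[P]_w (h (X 0%N w))%:E = mean%:E.
Hypothesis h_moment : \int[P]_w (h (X 0%N w) `^ (1 + dl))%:E <= C%:E.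

(** Truncate at the level n. The truncated sum has variance at most C n^(2-dl), the excess has mean
    at most C n^(-dl); after division by n the standard deviation, of order n^(-dl/2), decides the
    rate. *)
Lemma mean_deviation_le n : (0 < n)%N ->
  \int[P]_w `|n%:R^-1 * \sum_(i < n) h (X i w) - mean|%:E <=
  (3 * (C + 1) / n%:R `^ (dl / 2))%:E.
Proof.
move=> n0; have dl0 : (0 < dl)%R by case/andP: dl01.
pose N : R := n%:R%R; have N0 : (0 < N)%R by rewrite ltr0n.
pose s := (N `^ (dl / 2))%R.
have s0 : (0 < s)%R by exact: powR_gt0.
have ssE : (s * s = N `^ dl)%R.
  rewrite -powRD; last by rewrite (gt_eqF N0) implybT.
  by congr powR; lra.
have s1 : (1 <= s)%R.
  rewrite -(powRr0 N); apply: ler_powR; first by rewrite ler1n.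
  by rewrite divr_ge0// ltW.
pose F x := (Num.min (h x) N)%R.
have F0 x : (0 <= F x)%R by rewrite le_min h0 ltW.
have Fh x : (F x <= h x)%R by rewrite ge_min lexx.
have mF : measurable_fun setT F by exact: measurable_minr.
have mhX i : measurable_fun setT (fun w => h (X i w)).
  by apply: measurableT_comp => //; exact: measurable_funPT.
have mFX i : measurable_fun setT (fun w => F (X i w)).
  by apply: measurableT_comp => //; exact: measurable_funPT.
have mHX : measurable_fun setT (fun w => h (X 0%N w) `^ (1 + dl))%R.
  exact: (measurableT_comp (measurable_powR _)).
have C0 : (0 <= C)%R.
  rewrite -lee_fin; apply: le_trans h_moment.
  by apply: integral_ge0 => w _; rewrite lee_fin powR_ge0.
(* Finiteness comes together with the bound, since the variance identity takes its moments as real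
   numbers. *)
have int_le (G : T -> R) (k : R) : (0 < k)%R -> measurable_fun setT G ->
    (forall x, 0 <= G x)%R -> (forall x, G x * k <= h x `^ (1 + dl))%R ->
    exists2 y, (\int[P]_w (G (X 0%N w))%:E = y%:E) & (0 <= y <= C / k)%R.
  move=> k0 mG G0 Gk.
  have mGX : measurable_fun setT (fun w => G (X 0%N w)).
    by apply: measurableT_comp => //; exact: measurable_funPT.
  have I0 : 0 <= \int[P]_w (G (X 0%N w))%:E.
    by apply: integral_ge0 => w _; rewrite lee_fin.
  have IC : \int[P]_w (G (X 0%N w))%:E <= (C / k)%:E.
    have : \int[P]_w (k%:E * (G (X 0%N w))%:E) <= C%:E.
      apply: le_trans h_moment; apply: ge0_le_integral => //.
      - by move=> w _; rewrite lee_fin mulr_ge0// ltW.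
      - by apply/measurable_EFinP; exact: measurable_funM.
      - exact/measurable_EFinP.
      - by move=> w _; rewrite -EFinM lee_fin mulrC.
    rewrite ge0_integralZl_EFin//; last 3 first.
    - by move=> w _; rewrite lee_fin.
    - exact/measurable_EFinP.
    - exact: ltW.
    move: I0; case: (\int[P]_w _) => [y| |]//; last first.
      by rewrite mulry gtr0_sg// mul1e.
    by rewrite -EFinM !lee_fin ler_pdivlMr// mulrC.
  move: I0 IC; case: (\int[P]_w _) => [y| |]//; rewrite !lee_fin => y0 yC.
  by exists y => //; rewrite y0.
have [a aE /andP[a0 aC]] : exists2 y,
    (\int[P]_w (F (X 0%N w) ^+ 2)%:E = y%:E) & (0 <= y <= C / (s * s / N))%R.
  apply: (int_le (fun x => F x ^+ 2)%R).
  - by rewrite divr_gt0// mulr_gt0.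
  - exact: measurable_funX.
  - by move=> x; exact: sqr_ge0.
  - by move=> x; rewrite mulrA ssE ler_pdivrMr//; exact: minr_sqr_le_powR.
have [b bE /andP[b0 bC]] : exists2 y,
    (\int[P]_w (h (X 0%N w) - F (X 0%N w))%:E = y%:E) & (0 <= y <= C / (s * s))%R.
  apply: (int_le (fun x => h x - F x)%R).
  - by rewrite mulr_gt0.
  - exact: measurable_funB.
  - by move=> x; rewrite subr_ge0.
  - by move=> x; rewrite ssE; exact: subr_minr_le_powR.
have [m mE m0] : exists2 y, \int[P]_w (F (X 0%N w))%:E = y%:E & (mean = y + b)%R.
  have : \int[P]_w ((F (X 0%N w))%:E + (h (X 0%N w) - F (X 0%N w))%:E) = mean%:E.
    by rewrite -h_mean; apply: eq_integral => w _; rewrite -EFinD addrC subrK.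
  rewrite ge0_integralD//; last 4 first.
  - by move=> w _; rewrite lee_fin.
  - exact/measurable_EFinP.
  - by move=> w _; rewrite lee_fin subr_ge0.
  - by apply/measurable_EFinP; exact: measurable_funB.
  rewrite bE; case: (\int[P]_w _) => [y| |]// [] yb.
  by exists y.
have varF := iid_variance_sum X X_ident X_pindep F m a n mF F0 mE aE.
pose D w := (\sum_(i < n) F (X i w) - N * m)%R.
have mD : measurable_fun setT D by apply: measurable_funB => //; exact: measurable_sum.
pose E w := (\sum_(i < n) (h (X i w) - F (X i w)))%R.
have mE' : measurable_fun setT E.
  by apply: measurable_sum => i; exact: measurable_funB.
have E0 w : (0 <= E w)%R by apply: sumr_ge0 => i _; rewrite subr_ge0.
have EE : \int[P]_w (E w)%:E = (N * b)%:E.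
  under eq_integral do rewrite /E -sumEFin.
  rewrite ge0_integral_sum//; last 2 first.
  - by move=> i; apply/measurable_EFinP; exact: measurable_funB.
  - by move=> i w _; rewrite lee_fin subr_ge0.
  under eq_bigr => i _.
    rewrite (ident_integral X X_ident (fun x => (h x - F x)%:E))//; last 2 first.
    - by apply/measurable_EFinP; exact: measurable_funB.
    - by move=> x; rewrite lee_fin subr_ge0.
    rewrite bE; over.
  by rewrite sumEFin sumr_const card_ord -mulr_natl.
(* AM-GM with weight N / s, which balances the variance against 1 *)
pose tau : R := (N / s)%R.
have tau0 : (0 < tau)%R by rewrite divr_gt0.
have pw w : (`|n%:R^-1 * \sum_(i < n) h (X i w) - mean| <=
    N^-1 * (tau^-1 / 2 * D w ^+ 2 + (E w + (tau / 2 + N * b))))%R.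
  have -> : (n%:R^-1 * \sum_(i < n) h (X i w) - mean =
      N^-1 * (D w + E w - N * b))%R.
    have -> : (\sum_(i < n) h (X i w) = \sum_(i < n) F (X i w) + E w)%R.
      by rewrite /E -big_split/=; apply: eq_bigr => i _; rewrite addrC subrK.
    rewrite m0 /D -/N; field; exact: lt0r_neq0.
  rewrite normrM gtr0_norm ?invr_gt0// ler_pM2l ?invr_gt0//.
  have : (`|D w| <= tau^-1 / 2 * D w ^+ 2 + tau / 2)%R.
    have -> : (tau^-1 / 2 * D w ^+ 2 + tau / 2 = `|D w| + (`|D w| - tau) ^+ 2 / (2 * tau))%R.
      by rewrite -(real_normK (num_real (D w))); field; exact: lt0r_neq0.
    by rewrite lerDl divr_ge0 ?sqr_ge0// mulr_ge0// ltW.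
  have := ler_normB (D w + E w)%R (N * b)%R; have := ler_normD (D w) (E w).
  rewrite (ger0_norm (E0 w)) (ger0_norm (mulr_ge0 (ltW N0) b0)).
  by lra.
apply: (@le_trans _ _ (\int[P]_w (N^-1%:E *
    ((tau^-1 / 2)%:E * (D w ^+ 2)%:E + ((E w)%:E + (tau / 2 + N * b)%:E))))).
  apply: ge0_le_integral => //.
  - by apply/measurable_EFinP; apply: measurableT_comp => //;
      apply: measurable_funB => //; apply: measurable_funM => //; exact: measurable_sum.
  - apply: emeasurable_funM => //; apply: emeasurable_funD.
      by apply: emeasurable_funM => //; apply/measurable_EFinP; exact: measurable_funX.
    by apply: emeasurable_funD => //; exact/measurable_EFinP.
  - by move=> w _; rewrite -!EFinM lee_fin; exact: pw.
have tb0 : (0 <= tau / 2 + N * b)%R by have := mulr_ge0 (ltW N0) b0; lra.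
have t20 : (0 <= tau^-1 / 2)%R by rewrite divr_ge0// invr_ge0 ltW.
rewrite ge0_integralZl_EFin//; last 3 first.
- by move=> w _; rewrite !adde_ge0 ?mule_ge0 ?lee_fin ?sqr_ge0.
- apply: emeasurable_funD.
    by apply: emeasurable_funM => //; apply/measurable_EFinP; exact: measurable_funX.
  by apply: emeasurable_funD => //; exact/measurable_EFinP.
- by rewrite invr_ge0 ltW.
rewrite ge0_integralD//; last 4 first.
- by move=> w _; rewrite mule_ge0 ?lee_fin ?sqr_ge0.
- by apply: emeasurable_funM => //; apply/measurable_EFinP; exact: measurable_funX.
- by move=> w _; rewrite adde_ge0 ?lee_fin.
- by apply: emeasurable_funD => //; exact/measurable_EFinP.
rewrite ge0_integralZl_EFin//; last 2 first.
- by move=> w _; rewrite lee_fin sqr_ge0.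
- by apply/measurable_EFinP; exact: measurable_funX.
rewrite ge0_integralD//; last 2 first.
- by move=> w _; rewrite lee_fin.
- exact/measurable_EFinP.
rewrite varF EE integral_cst//= (_ : P setT = 1) ?mule1; last exact: probability_setT.
apply: (@le_trans _ _ (N^-1 * (tau^-1 / 2 * (N * (a - m ^+ 2)) +
  (N * b + (tau / 2 + N * b))))%:E); first exact: lexx.
rewrite lee_fin -/N -/s.
have sN : (s * s <= N * (s * s))%R.
  by rewrite ler_peMl ?mulr_ge0 ?(ltW s0)// ler1n.
have H1 : (N^-1 * (tau^-1 / 2 * (N * (a - m ^+ 2))) <= C / s / 2)%R.
  have -> : (N^-1 * (tau^-1 / 2 * (N * (a - m ^+ 2))) = s / N * (a - m ^+ 2) / 2)%R.
    by rewrite /tau; field; rewrite !lt0r_neq0.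
  rewrite ler_pM2r ?invr_gt0//.
  apply: (@le_trans _ _ (s / N * (C / (s * s / N)))%R).
    rewrite ler_wpM2l ?divr_ge0 ?(ltW s0) ?(ltW N0)//.
    by apply: le_trans aC; rewrite gerBl sqr_ge0.
  rewrite le_eqVlt; apply/orP; left; apply/eqP; field.
  by rewrite !lt0r_neq0.
have H2 : (N^-1 * (N * b) <= C / s)%R.
  rewrite mulKf ?lt0r_neq0//. apply: (le_trans bC).
  rewrite invfM mulrA ler_piMr ?divr_ge0// ?(ltW s0)//.
  by rewrite invf_le1.
have H3 : (N^-1 * (tau / 2) = s^-1 / 2)%R.
  by rewrite /tau; field; rewrite !lt0r_neq0.
have H4 : (0 < s^-1)%R by rewrite invr_gt0.
have H5 : (0 <= C / s)%R by rewrite divr_ge0// ltW.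
rewrite mulrDr [X in (_ + X <= _)%R]mulrDr [X in (_ + (_ + X) <= _)%R]mulrDr H3.
rewrite [leRHS](_ : _ = 3 * (C / s) + 3 * s^-1)%R; last by ring.
by lra.
Qed.

End mean_deviation.

(* The averages of a nondecreasing sequence converge as soon as they converge
   along the p-th powers, whose consecutive ratios tend to 1. *)
Lemma cvg_average_of_powers {R : realType} (u : nat -> R) (l : R) (p : nat) :
  (0 < p)%N -> (forall n, 0 <= u n) -> nondecreasing_seq u ->
  (fun k => ((k.+1 ^ p)%N)%:R^-1 * u (k.+1 ^ p)%N) @ \oo --> l ->
  (fun n => n%:R^-1 * u n) @ \oo --> l.
Proof.
move=> p0 u0 ndu; set v := (fun k : nat => _) => vl.
pose ratio (k : nat) : R := (1 + k.+1%:R^-1) ^+ p.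
have ratioE k : ratio k = (k.+2 ^ p)%N%:R / (k.+1 ^ p)%N%:R.
  rewrite !natrX -expr_div_n; congr (_ ^+ p).
  by rewrite -[k.+2%:R]natr1 mulrDl divff ?mul1r// pnatr_eq0.
have ratio0 k : 0 < ratio k by rewrite exprn_gt0// addr_gt0// invr_gt0.
have ratio1 : ratio @ \oo --> (1 : R).
  have h : (fun k => 1 + k.+1%:R^-1) @ \oo --> (1 : R).
    by rewrite -[X in _ --> X]addr0; apply: cvgD; [exact: cvg_cst|exact: cvg_harmonic].
  have := @continuous_cvg _ _ _ _ _ _ (fun x : R => x ^+ p) _ (@exprn_continuous R p _) h.
  by rewrite expr1n => hp; exact: hp.
have lo : (fun k => v k / ratio k) @ \oo --> l.
  suff : (fun k => v k * (ratio k)^-1) @ \oo --> l * 1^-1 by rewrite invr1 mulr1.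
  by apply: cvgM => //; apply: cvgV => //; exact: oner_neq0.
have up : (fun k => v k.+1 * ratio k) @ \oo --> l.
  rewrite -[X in _ --> X]mulr1; apply: cvgM => //.
  by move: vl; rewrite -(cvg_shiftS v).
apply/cvgrPdist_le => e e0.
move/cvgrPdist_le/(_ e e0) : lo => [K1 _ lo].
move/cvgrPdist_le/(_ e e0) : up => [K2 _ up].
exists ((maxn K1 K2).+1 ^ p)%N => // n /= Kn.
have n0 : (0 < n)%N by apply: leq_trans Kn; rewrite expn_gt0.
have [k kn nk] : exists2 k, (k.+1 ^ p <= n)%N & (n < k.+2 ^ p)%N.
  have ex1 : exists N, (N ^ p <= n)%N by exists 0%N; rewrite exp0n.
  have exM N : (N ^ p <= n)%N -> (N <= n)%N.
    apply: leq_trans; case: N => // N.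
    by rewrite -[X in (X <= _)%N]expn1 leq_pexp2l.
  case: (ex_maxnP ex1 exM) => -[|k] kn kmax.
    by have := kmax 1%N; rewrite exp1n n0 => /(_ isT).
  exists k => //; rewrite ltnNge; apply/negP => /kmax.
  by rewrite ltnn.
have Kk : (maxn K1 K2 <= k)%N.
  by have := leq_ltn_trans Kn nk; rewrite ltn_exp2r// ltnS.
set a : R := (k.+1 ^ p)%N%:R; set b : R := (k.+2 ^ p)%N%:R.
have a0 : 0 < a by rewrite ltr0n expn_gt0.
have b0 : 0 < b by rewrite ltr0n expn_gt0.
have nR : 0 < n%:R :> R by rewrite ltr0n.
(* Between the powers a <= n < b monotonicity gives u_a / b <= u_n / n <= u_b / a; putting the right
   denominators back costs the factor [ratio k] on either side. *)
have lo_le : v k / ratio k <= n%:R^-1 * u n.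
  have -> : v k / ratio k = b^-1 * u (k.+1 ^ p)%N.
    by rewrite ratioE /v -/a -/b; field; rewrite !lt0r_neq0.
  by rewrite ler_pM ?invr_ge0 ?(ltW b0)//; [rewrite lef_pV2 ?posrE// ler_nat ltnW|exact: ndu].
have up_ge : n%:R^-1 * u n <= v k.+1 * ratio k.
  have -> : v k.+1 * ratio k = a^-1 * u (k.+2 ^ p)%N.
    by rewrite ratioE /v -/a -/b; field; rewrite !lt0r_neq0.
  by rewrite ler_pM ?invr_ge0 ?(ltW nR)//;
    [rewrite lef_pV2 ?posrE// ler_nat|exact/ndu/ltnW].
have /ler_normlP[_ H1] := lo k (leq_trans (leq_maxl _ _) Kk).
have /ler_normlP[H2 _] := up k (leq_trans (leq_maxr _ _) Kk).
by apply/ler_normlP; split; lra.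
Qed.

Section slln.
Local Open Scope ereal_scope.
Context {R : realType} {dO dT : measure_display} {Omega : measurableType dO}
  {T : measurableType dT} {P : probability Omega R}.
Variable X : nat -> {RV P >-> T}.
Hypothesis X_ident : forall i (A : set T), measurable A ->
  P (X i @^-1` A) = P (X 0%N @^-1` A).
Hypothesis X_pindep : forall i j (A B : set T), i != j -> measurable A ->
  measurable B ->
  P (X i @^-1` A `&` X j @^-1` B) = P (X i @^-1` A) * P (X j @^-1` B).

(* The mean deviation over n terms is O(n^(-dl/2)), hence summable along
   n = (k+1)^p for p large. *)
Lemma strong_law_pairwise_iid (h : T -> R) (dl mean C : R) :
  measurable_fun setT h -> (forall x, (0 <= h x)%R) -> (0 < dl <= 1)%R ->
  \int[P]_w (h (X 0%N w))%:E = mean%:E ->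
  \int[P]_w (h (X 0%N w) `^ (1 + dl))%:E <= C%:E ->
  {ae P, forall w, ((n%:R^-1 * \sum_(i < n) h (X i w))%R @[n --> \oo] --> mean)}.
Proof.
move=> mh h0 dl01 h_mean h_moment; have /andP[dl0 dl1] := dl01.
have C0 : (0 <= C)%R.
  rewrite -lee_fin; apply: le_trans h_moment.
  by apply: integral_ge0 => w _; rewrite lee_fin powR_ge0.
(* This makes p dl / 2 >= 2, so that the rate along the p-th powers is at most a constant times
   (k+1)^(-2). *)
pose p := (Num.truncn (4 / dl)).+1.
have pdl : (2 <= p%:R * (dl / 2))%R.
  have : (4 / dl < p%:R)%R by exact: truncnS_gt.
  by rewrite ltr_pdivrMr// => ?; lra.
pose D k w : R := `|((k.+1 ^ p)%N%:R^-1 * \sum_(i < k.+1 ^ p) h (X i w) - mean)%R|%R.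
have D_ge0 k w : 0 <= (D k w)%:E by rewrite lee_fin /D.
have mhX i : measurable_fun setT (fun w => h (X i w)).
  by apply: measurableT_comp => //; exact: measurable_funPT.
have mD k : measurable_fun setT (EFin \o D k).
  apply/measurable_EFinP; apply: measurableT_comp => //.
  apply: measurable_funB => //; apply: measurable_funM => //.
  exact: measurable_sum.
have ED k : \int[P]_w (D k w)%:E <= (3 * (C + 1) * (k.+1%:R ^+ 2)^-1)%:E.
  apply: le_trans (mean_deviation_le X X_ident X_pindep h dl mean C mh h0
    dl01 h_mean h_moment _ _) _; first by rewrite expn_gt0.
  rewrite lee_fin ler_wpM2l ?mulr_ge0 ?addr_ge0//.
  rewrite lef_pV2 ?posrE ?exprn_gt0 ?powR_gt0// ?ltr0n ?expn_gt0//.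
  rewrite natrX -powR_mulrn// -powRrM -powR_mulrn//.
  by apply: ler_powR => //; rewrite ler1n.
have sumD : \int[P]_w \sum_(k <oo) (D k w)%:E < +oo.
  rewrite (integral_nneseries P measurableT mD)//; last by move=> k w _; exact: D_ge0.
  apply: (@le_lt_trans _ _ (6 * (C + 1))%:E); last exact: ltry.
  apply: lime_le.
    apply: is_cvg_nneseries => k _ _; apply: integral_ge0 => w _. exact: D_ge0.
  apply: nearW => n.
  apply: (@le_trans _ _ (\sum_(0 <= k < n) (3 * (C + 1) * (k.+1%:R ^+ 2)^-1)%:E)).
    by apply: lee_sum => k _; exact: ED.
  rewrite sumEFin lee_fin -mulr_sumr.
  (* Telescoping, from 1/x^2 <= 2/x - 2/(x+1) for x >= 1. *)
  have : (\sum_(0 <= k < n) (k.+1%:R ^+ 2)^-1 <= 2 - 2 * n.+1%:R^-1 :> R)%R.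
    elim: n => [|n IH]; first by rewrite big_nil invr1; lra.
    rewrite big_nat_recr//=.
    have : ((n.+1%:R ^+ 2)^-1 <= 2 * n.+1%:R^-1 - 2 * n.+2%:R^-1 :> R)%R.
      have n1 : (1 <= n.+1%:R :> R)%R by rewrite ler1n.
      rewrite -[n.+2%:R]natr1; move: (n.+1%:R) n1 => x x1.
      rewrite -subr_ge0.
      have -> : (2 / x - 2 / (x + 1) - (x ^+ 2)^-1 =
         (x - 1) / (x ^+ 2 * (x + 1)))%R.
        by field; rewrite !lt0r_neq0//; lra.
      by rewrite divr_ge0 ?mulr_ge0 ?sqr_ge0//; lra.
    by move=> /(lerD IH)/le_trans; apply; rewrite addrA subrK.
  have : (0 < n.+1%:R^-1 :> R)%R by rewrite invr_gt0.
  move=> H1 H2; rewrite (_ : 6 * (C + 1) = 3 * (C + 1) * 2)%R; last by ring.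
  rewrite ler_wpM2l ?mulr_ge0 ?addr_ge0//.
  by apply: (le_trans H2); rewrite gerBl mulr_ge0// ltW.
have mS : measurable_fun setT (fun w => \sum_(k <oo) (D k w)%:E).
  apply: ge0_emeasurable_sum; first by move=> k w _ _; exact: D_ge0.
  by move=> k _; exact: mD.
have S0 w : 0 <= \sum_(k <oo) (D k w)%:E
  by apply: nneseries_ge0 => k _ _; exact: D_ge0.
have iS : P.-integrable setT (fun w => \sum_(k <oo) (D k w)%:E).
  apply/integrableP; split => //.
  by under eq_integral do rewrite gee0_abs//.
(* The sum of the deviations has finite expectation, so it is almost surely finite and its terms
   tend to 0. *)
have := integrable_ae measurableT iS.
apply: filterS => w /(_ Logic.I) Sfin.
apply: (@cvg_average_of_powers _ (fun n => \sum_(i < n) h (X i w))%R _ p) => //.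
- by move=> n; exact: sumr_ge0.
- apply/nondecreasing_seqP => n.
  by rewrite big_ord_recr/= lerDl.
have /cvg_series_cvg_0 D0 : cvgn (series (D ^~ w)).
  apply: nnseries_is_cvg; first by move=> k; rewrite /D.
  by rewrite -ge0_fin_numE.
apply/cvgrPdist_le => e e0 /=.
move/cvgrPdist_le/(_ e e0) : D0; apply: filterS => k.
by rewrite sub0r normrN /D normr_id distrC.
Qed.

End slln.

(** * Outer almost sure convergence *)

Section minimal_majorant.
Local Open Scope ereal_scope.
Context {R : realType} {dO : measure_display} {Omega : measurableType dO}.
Variable P : probability Omega R.

(** Intersecting measurable supersets with probabilities tending to the infimum gives a superset [H]
    that attains it. For any measurable [B] containing [A], [H] intersected with [B] is again such a
    superset and cannot have smaller probability, so the difference is null. *)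
Lemma measurable_hull (A : set Omega) : exists H : set Omega,
  [/\ measurable H, A `<=` H &
      forall B, measurable B -> A `<=` B -> P (H `\` B) = 0].
Proof.
pose S := [set P B | B in [set B : set Omega | measurable B /\ A `<=` B]].
have i0 : 0 <= ereal_inf S.
  by apply: le_ereal_inf_tmp => _ [B _ <-]; exact: measure_ge0.
have i1 : ereal_inf S <= 1.
  apply: ereal_inf_lbound; exists setT; last exact: probability_setT.
  by split.
have ifin : ereal_inf S \is a fin_num.
  by rewrite ge0_fin_numE//; apply: le_lt_trans i1 _; exact: ltry.
have /choice[B BP] : forall k : nat, exists B : set Omega,
    [/\ measurable B, A `<=` B & P B < ereal_inf S + (k.+1%:R^-1)%:E].
  move=> k.
  have k0 : (0 < k.+1%:R^-1 :> R)%R by rewrite invr_gt0.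
  have [_ [B [mB AB] <-] PB] := lb_ereal_inf_adherent k0 ifin.
  by exists B.
have mB k : measurable (B k) by have [] := BP k.
pose H := \bigcap_k B k.
have mH : measurable H by exact: bigcapT_measurable.
have AH : A `<=` H by move=> w Aw k _; have [_ + _] := BP k; apply.
have PH : P H <= ereal_inf S.
  apply/lee_addgt0Pr => e e0.
  have [k ke] : exists k : nat, (k.+1%:R^-1 < e)%R.
    exists (Num.truncn e^-1).
    by rewrite invf_plt ?posrE// truncnS_gt.
  apply: (@le_trans _ _ (P (B k))).
    by apply: le_measure; rewrite ?inE//; exact: bigcap_inf.
  have [_ _ /ltW/le_trans] := BP k; apply.
  by rewrite leeD2l// lee_fin ltW.
exists H; split => // C mC AC.
have iHC : ereal_inf S <= P (H `&` C).
  apply: ereal_inf_lbound; exists (H `&` C) => //; split.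
    exact: measurableI.
  by move=> w Aw; split; [exact: AH|exact: AC].
apply/eqP; rewrite -measure_le0 measureD//; last first.
  by rewrite (le_lt_trans PH)// -ge0_fin_numE.
by rewrite sube_le0 (le_trans PH).
Qed.

(** [U] is the supremum of the rationals q over the points of the hull of {T > q}. A measurable V >=
    T makes {V > q} a measurable superset of {T > q}, so it contains that hull up to a null set. *)
Lemma minimal_majorant_exists (T : Omega -> \bar R) :
  exists U, minimal_majorant P T U.
Proof.
(* Enumerates the rationals; a code that decodes to no rational stands for 0. *)
pose q (n : nat) : R := ratr (odflt 0%R (unpickle n : option rat)).
have /choice[H HP] := fun n => measurable_hull [set w | (q n)%:E < T w].
have mH n : measurable (H n) by have [] := HP n.
pose f (n : nat) (w : Omega) : \bar R := if w \in H n then (q n)%:E else -oo.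
have mf n : measurable_fun setT (f n).
  apply: measurable_fun_if => //.
  by apply: (measurable_fun_bool true); rewrite setTI (_ : _ @^-1` _ = H n)//;
    apply/seteqP; split => w /=; [exact: set_mem|exact: mem_set].
pose U w := esups (f ^~ w) 0%N.
have fU n w : f n w <= U w by apply: ereal_sup_ubound; exists n.
have dense (x y : \bar R) : x < y -> exists n, x < (q n)%:E < y.
  have rat_between (s t : R) : (s < t)%R -> exists n, (s < q n < t)%R.
    move=> /rat_in_itvoo[r]; rewrite in_itv/= => rst.
    by exists (pickle r); rewrite /q pickleK.
  case: x y => [x| |] [y| |]//=; rewrite ?lte_fin.
  - by move=> /rat_between.
  - move=> _; have [n /andP[xn _]] := rat_between x (x + 1)%R (ltr_pwDr ltr01 (lexx _)).
    by exists n; rewrite lte_fin xn ltry.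
  - move=> _; have y1 : (y - 1 < y)%R by rewrite gtrBl.
    have [n /andP[_ ny]] := rat_between _ _ y1.
    by exists n; rewrite lte_fin ny ltNyr.
  - by move=> _; exists 0%N; rewrite ltNyr ltry.
exists U; split.
- exact: measurable_fun_esups.
- move=> w; rewrite leNgt; apply/negP => /dense[n /andP[Uq qT]].
  have [_ /(_ w qT) Hw _] := HP n.
  by move: Uq; rewrite ltNge => /negP; apply; apply: le_trans (fU n w); rewrite /f mem_set.
- move=> V mV [N [mN PN TV]].
  (* The null set [N], outside which T <= V, is adjoined to {V > q}, because [measurable_hull] asks
     for inclusion at every point. *)
  have ae_n n : {ae P, forall w, H n w -> (q n)%:E < V w \/ N w}.
    exists (H n `\` ([set w | (q n)%:E < V w] `|` N)); split.
    + apply: measurableD => //; apply: measurableU => //.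
      by rewrite -[X in measurable X]setTI; apply: emeasurable_fun_o_infty.
    + have [_ _ ->]// := HP n.
        apply: measurableU => //.
        by rewrite -[X in measurable X]setTI; apply: emeasurable_fun_o_infty.
      move=> w /= qT; have [TVw|nTV] := pselect (T w <= V w).
        by left; exact: lt_le_trans TVw.
      by right; exact: TV.
    + move=> w /= nw; split; first by apply: contrapT => nH; apply: nw.
      by move=> VN; apply: nw => _.
  have aeN : {ae P, forall w, ~ N w}.
    by exists N; split => // w /= /contrapT.
  have : {ae P, forall w, forall n, H n w -> (q n)%:E < V w \/ N w}.
    exact: ae_foralln.
  apply: filterS2 aeN => w nN HV.
  apply: ge_ereal_sup => _ [n _ <-]; rewrite /f; case: ifPn => [|_]; last exact: leNye.
  by rewrite inE => /HV[/ltW|].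
Qed.

End minimal_majorant.

(** The event [W n w <= eta] is measurable, so e on it and +oo off it is a measurable majorant of
    the distance and dominates the minimal one almost surely. Running through the tolerances 1/(k+1)
    leaves only countably many exceptional sets. *)
Lemma as_outer_cvg_criterion {R : realType} {dO : measure_display}
    {Omega : measurableType dO} (P : probability Omega R)
    (Z : nat -> Omega -> \bar R) (z : \bar R) :
  (forall e : R, 0 < e -> exists (W : nat -> Omega -> R) (eta : R),
    [/\ 0 < eta, forall n, measurable_fun setT (W n),
        {ae P, forall w, W n w @[n --> \oo] --> 0} &
        forall n w, (0 < n)%N -> W n w <= eta -> (`|Z n w - z| <= e%:E)%E]) ->
  as_outer_cvg P Z z.
Proof.
move=> HZ.
have /choice[U Umaj] := fun n => minimal_majorant_exists P (fun w => `|Z n w - z|)%E.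
exists U; split => //.
have /choice[W WP] : forall k : nat, exists W : nat -> Omega -> R, exists eta : R,
    [/\ 0 < eta, forall n, measurable_fun setT (W n),
        {ae P, forall w, W n w @[n --> \oo] --> 0} &
        forall n w, (0 < n)%N -> W n w <= eta -> (`|Z n w - z| <= (k.+1%:R^-1)%:E)%E].
  by move=> k; apply: HZ; rewrite invr_gt0.
have /choice[eta {}WP] := WP.
pose V k n w : \bar R := if W k n w <= eta k then (k.+1%:R^-1)%:E else +oo%E.
have UV : {ae P, forall w, forall k n, (0 < n)%N -> (U n w <= V k n w)%E}.
  apply: ae_foralln => k; apply: ae_foralln => n.
  have [->|n0] := posnP n; first exact: aeW.
  have [eta0 mW _ WZ] := WP k; have [_ _ Umin] := Umaj n.
  have : {ae P, forall w, (U n w <= V k n w)%E}.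
    apply: Umin.
      apply: measurable_fun_if => //.
        by apply: measurable_fun_ler.
    apply: aeW => w; rewrite /V; case: ifPn => [|_]; last exact: leey.
    exact: WZ.
  by apply: filterS.
have W0 : {ae P, forall w, forall k, W k n w @[n --> \oo] --> 0}.
  by apply: ae_foralln => k; have [_ _ ? _] := WP k.
apply: filterS2 UV W0 => w UV W0.
have U0 n : (0%R <= U n w)%E by have [_ /(_ w) + _] := Umaj n; exact: le_trans.
have Uk k : \forall n \near \oo, (U n w <= (k.+1%:R^-1)%:E)%E.
  have [eta0 _ _ _] := WP k.
  have /cvgrPdist_le/(_ _ eta0) := W0 k; apply: filter_app.
  exists 1%N => // n /= n1; rewrite sub0r normrN => /ler_normlW WE.
  by apply: (le_trans (UV k n n1)); rewrite /V WE.
have Ufin n (x : R) : (U n w <= x%:E)%E -> U n w \is a fin_num.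
  by move=> Ux; rewrite ge0_fin_numE//; apply: (le_lt_trans Ux); exact: ltry.
apply/fine_cvgP; split.
  by apply: filterS (Uk 0%N) => n; exact: Ufin.
apply/cvgrPdist_le => e e0.
have [k ke] : exists k : nat, k.+1%:R^-1 <= e.
  exists (Num.truncn e^-1).
  by apply: ltW; rewrite invf_plt ?posrE// truncnS_gt.
apply: filterS (Uk k) => n Un; rewrite sub0r normrN ger0_norm ?fine_ge0//.
by apply: le_trans ke; rewrite -lee_fin fineK//; exact: Ufin Un.
Qed.

(** * Grid brackets of orthounimodal functions *)

Section antitone.
Context {R : realType} {d : nat}.
Local Notation Rd := (d.-tuple R).
Implicit Types (a b x y : Rd) (f : Rd -> R).

(** Pass from [x] to [y] by replacing one coordinate at a time, which stays in the box. Conversely,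
    the non-decreasing clause is met only when [tnth y i <= tnth a i], and this forces x = y. *)
Lemma orthounimodal_corner a b f :
  orthounimodal_on (box a b) a f <->
  (forall x y, box a b x -> box a b y -> cle x y -> f y <= f x).
Proof.
split=> [uf x y [ax xb] [ay yb] xy|anti i x y Dx Dy eqxy xyi].
  pose z (t : nat) : Rd := [tuple if (i < t)%N then tnth y i else tnth x i | i < d].
  have zbox t : box a b (z t).
    by split => i; rewrite tnth_mktuple; case: ifP.
  have -> : x = z 0%N by apply: eq_from_tnth => i; rewrite tnth_mktuple.
  have -> : y = z d by apply: eq_from_tnth => i; rewrite tnth_mktuple ltn_ord.
  suff H t : (t <= d)%N -> f (z t) <= f (z 0%N) by exact: H.
  elim: t => // t IH td; apply: le_trans (IH (ltnW td)).
  have e1 j : j != Ordinal td -> tnth (z t) j = tnth (z t.+1) j.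
    move=> jt; rewrite !tnth_mktuple ltnS (leq_eqVlt j t).
    by move: jt; rewrite -val_eqE /= => /negbTE ->.
  have e2 : tnth (z t) (Ordinal td) <= tnth (z t.+1) (Ordinal td).
    by rewrite !tnth_mktuple/= ltnn ltnSn.
  have [_] := uf (Ordinal td) (z t) (z t.+1) (zbox _) (zbox _) e1 e2; apply.
  by rewrite tnth_mktuple ltnn; exact: ax.
have xy : cle x y.
  by move=> j; have [->//|/eqxy ->] := eqVneq j i.
split; last by move=> _; exact: anti.
move=> ya; suff -> : x = y by [].
apply: eq_from_tnth => j; have [->|/eqxy//] := eqVneq j i.
apply/eqP; rewrite eq_le xyi/=; apply: (le_trans ya).
by case: Dx.
Qed.

Lemma shape_class_antitone a b (M : R) f : shape_class a b M f <->
  (forall x, box a b x -> 0 <= f x <= M) /\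
  (forall x y, box a b x -> box a b y -> cle x y -> f y <= f x).
Proof. by split=> -[fM /orthounimodal_corner]. Qed.

End antitone.

(* The diagonal shift c -> c + 1 pairs all terms except those with c on a lower
   face, of which there are at most d (k+1)^(d-1). *)
Lemma sum_diagonal_difference {R : realType} (d k : nat) (M : R)
    (G : ('I_d -> nat) -> R) :
  (forall c : 'I_d -> nat, (forall i, (c i <= k.+1)%N) -> 0 <= G c <= M) ->
  k.+1%:R * \sum_(c : {ffun 'I_d -> 'I_k.+1})
    (G (fun i => c i) - G (fun i => (c i).+1)) <= M * d%:R * k.+1%:R ^+ d.
Proof.
move=> GM.
have G0 (c : {ffun 'I_d -> 'I_k.+1}) : 0 <= G (fun i => c i) <= M.
  by apply: GM => i; exact: ltnW.
have G1 (c : {ffun 'I_d -> 'I_k.+1}) : 0 <= G (fun i => (c i).+1) <= M.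
  by apply: GM => i.
have M0 : 0 <= M.
  by have /andP[/le_trans] := G0 [ffun=> ord0]; apply.
pose pos (c : {ffun 'I_d -> 'I_k.+1}) := [forall i, (0 < c i)%N].
pose small (c : {ffun 'I_d -> 'I_k.+1}) := [forall i, (c i < k)%N].
have shift : \sum_(c : {ffun 'I_d -> 'I_k.+1} | pos c) G (fun i => c i) <=
      \sum_(c : {ffun 'I_d -> 'I_k.+1}) G (fun i => (c i).+1).
  pose pre (c : {ffun 'I_d -> 'I_k.+1}) : {ffun 'I_d -> 'I_k.+1} :=
    [ffun i => inord (c i).-1].
  (* [inord] sends the out-of-range index [k.+1] to 0, so all coordinates of [suc c] are positive
     exactly when [c] is [small]. *)
  pose suc (c : {ffun 'I_d -> 'I_k.+1}) : {ffun 'I_d -> 'I_k.+1} :=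
    [ffun i => inord (c i).+1].
  rewrite (reindex_onto suc pre) /=; last first.
    move=> c /forallP pc; apply/ffunP => i; rewrite !ffunE; apply: val_inj.
    rewrite /= inordK; last by rewrite inordK prednK// ltnW.
    by rewrite inordK ?prednK// ltnW// prednK.
  rewrite [leRHS](bigID small)/= -[leLHS]addr0 lerD//; last first.
    by apply: sumr_ge0 => c _; have /andP[] := G1 c.
  rewrite le_eqVlt; apply/orP; left; apply/eqP; apply: eq_big.
    move=> c; apply/andP/idP => [[/forallP psc _]|/forallP sc].
      apply/forallP => i; move: (psc i); rewrite ffunE /inord val_insubd ltnS.
      by case: ifP => //= _; rewrite ltnn.
    split; first by apply/forallP => i; rewrite ffunE inordK// ltnS.
    apply/eqP/ffunP => i; rewrite !ffunE; apply: val_inj.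
    by rewrite /= [in LHS]inordK inordK ?ltnS//= ltnW.
  move=> c /andP[/forallP psc _]; congr G; apply/funext => i.
  move: (psc i); rewrite ffunE /inord val_insubd.
  by case: ifP.
have count : \sum_(c : {ffun 'I_d -> 'I_k.+1} | ~~ pos c) G (fun i => c i) <=
    M * (\sum_(i < d) #|[pred c : {ffun 'I_d -> 'I_k.+1} | c i == ord0]|)%N%:R.
  have -> : (\sum_(i < d) #|[pred c : {ffun 'I_d -> 'I_k.+1} | c i == ord0]| =
     \sum_(c : {ffun 'I_d -> 'I_k.+1}) \sum_(i < d) (c i == ord0))%N.
    rewrite exchange_big/=; apply: eq_bigr => i _.
    by rewrite -sum1_card [LHS]big_mkcond.
  rewrite natr_sum mulr_sumr [leRHS](bigID pos)/= -[leLHS]add0r lerD//.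
    by apply: sumr_ge0 => c _; rewrite mulr_ge0.
  apply: ler_sum => c /forallPn[i]; rewrite -eqn0Ngt => ci.
  have /andP[_ /le_trans] := G0 c; apply; rewrite ler_peMr// ler1n lt0n.
  by rewrite sum_nat_eq0; apply/forallPn; exists i; rewrite negb_imply/= -val_eqE/= ci.
(* Multiplying by [k.+1] avoids the exponent d - 1; the factor [k.+1%:R] in the statement has the
   same origin. *)
have card0 (i : 'I_d) :
    (#|[pred c : {ffun 'I_d -> 'I_k.+1} | c i == ord0]| * k.+1 = k.+1 ^ d)%N.
  rewrite (_ : #|_| = #|family (fun j : 'I_d => if j == i then pred1 (ord0 : 'I_k.+1) else predT)|).
    rewrite card_family foldrE big_map big_enum /= (bigD1 i)//= eqxx card1 mul1n.
    rewrite (eq_bigr (fun=> k.+1)); last first.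
      by move=> j /negbTE ->; rewrite card_ord.
    rewrite prod_nat_const cardC1 card_ord mulnC -expnS prednK//.
    by apply: leq_ltn_trans (ltn_ord i).
  apply: eq_card => c; rewrite !inE; apply/eqP/familyP => [ci j|/(_ i)].
    by case: eqP => [->|_]; rewrite ?inE ?ci.
  by rewrite eqxx inE => /eqP.
rewrite sumrB (bigID pos)/=.
apply: (@le_trans _ _ (k.+1%:R * (M * (\sum_(i < d)
    #|[pred c : {ffun 'I_d -> 'I_k.+1} | c i == ord0]|)%N%:R))).
  by rewrite ler_wpM2l//; move: shift count; lra.
rewrite mulrCA -natrM mulnC big_distrl/= (eq_bigr (fun=> k.+1 ^ d)%N); last first.
  by move=> i _; exact: card0.
by rewrite sum_nat_const card_ord natrM natrX mulrA.
Qed.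

Section grid.
Context {R : realType} {d : nat}.
Local Notation Rd := (d.-tuple R).
Variables (a b : Rd) (k : nat).
Hypothesis ab : cle a b.
Implicit Types (c : {ffun 'I_d -> 'I_k.+1}) (x : Rd).

Definition mesh (i : 'I_d) : R := (tnth b i - tnth a i) / k.+1%:R.

Definition grid_point (c : 'I_d -> nat) : Rd :=
  [tuple tnth a i + (c i)%:R * mesh i | i < d].

Definition low c : Rd := grid_point (fun i => c i).
Definition up c : Rd := grid_point (fun i => (c i).+1).

(* Half-open except on the upper faces of the box, so that the cells partition it. *)
Definition cell c : set Rd :=
  [set x | box (low c) (up c) x /\
           forall i, (c i < k)%N -> tnth x i < tnth (up c) i].

Let mesh_ge0 i : 0 <= mesh i.
Proof. by rewrite divr_ge0// subr_ge0. Qed.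

Let mesh_top i : tnth a i + k.+1%:R * mesh i = tnth b i.
Proof. by rewrite /mesh mulrC divfK ?pnatr_eq0// addrC subrK. Qed.

Lemma grid_point_box (c : 'I_d -> nat) :
  (forall i, (c i <= k.+1)%N) -> box a b (grid_point c).
Proof.
move=> ck; split=> i; rewrite tnth_mktuple; first by rewrite lerDl mulr_ge0.
by rewrite -mesh_top lerD2l ler_wpM2r// ler_nat.
Qed.

Lemma low_box c : box a b (low c).
Proof. by apply: grid_point_box => i; exact: ltnW. Qed.

Lemma up_box c : box a b (up c).
Proof. exact: grid_point_box. Qed.

Lemma low_le_up c : cle (low c) (up c).
Proof. by move=> i; rewrite !tnth_mktuple lerD2l ler_wpM2r// ler_nat. Qed.

Lemma cell_sub c : cell c `<=` box a b.
Proof.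
move=> x [[lx xu] _]; have [al _] := low_box c; have [_ ub] := up_box c.
by split=> i; [exact: le_trans (lx i)|exact: le_trans (ub i)].
Qed.

Lemma cell_cover x : box a b x -> exists c, cell c x.
Proof.
move=> [ax xb].
have ex i : exists c : 'I_k.+1, tnth a i + c%:R * mesh i <= tnth x i <=
      tnth a i + c.+1%:R * mesh i /\
    ((c < k)%N -> tnth x i < tnth a i + c.+1%:R * mesh i).
  (* Take the largest such index: maximality gives the strict upper bound when it is below [k], and
     at [k] the upper end is the face of [b]. *)
  pose Q t := (t <= k)%N && (tnth a i + t%:R * mesh i <= tnth x i).
  have ex0 : exists t, Q t by exists 0%N; rewrite /Q leq0n mul0r addr0 ax.
  have exk t : Q t -> (t <= k)%N by case/andP.
  case: (ex_maxnP ex0 exk) => t /andP[tk tx] tmax.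
  have lt_up : (t < k)%N -> tnth x i < tnth a i + t.+1%:R * mesh i.
    move=> t_lt; rewrite ltNge; apply/negP => xt.
    by have := tmax t.+1; rewrite /Q t_lt xt ltnn => /(_ isT).
  exists (Ordinal (tk : (t < k.+1)%N)) => /=; split => //; rewrite tx/=.
  move: tk; rewrite leq_eqVlt => /predU1P[->|/lt_up/ltW//].
  by rewrite mesh_top.
have /choice[c cP] := ex.
exists [ffun i => c i]; split; first split=> i.
- by rewrite tnth_mktuple ffunE; have [/andP[]] := cP i.
- by rewrite tnth_mktuple ffunE; have [/andP[]] := cP i.
- by move=> i; rewrite tnth_mktuple ffunE; have [_] := cP i.
Qed.

Lemma cell_inj c c' x : cell c x -> cell c' x -> c = c'.
Proof.
have H (c1 c2 : {ffun 'I_d -> 'I_k.+1}) i : cell c1 x -> cell c2 x ->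
    (c2 i <= c1 i)%N.
  move=> [_ ub] [[lx _] _]; rewrite leqNgt; apply/negP => c12.
  have /ub : (c1 i < k)%N by apply: leq_trans c12 _; rewrite -ltnS ltn_ord.
  rewrite ltNge => /negP; apply; apply: le_trans (lx i).
  by rewrite !tnth_mktuple lerD2l ler_wpM2r// ler_nat.
move=> cx c'x; apply/ffunP => i; apply/val_inj/eqP.
by rewrite eqn_leq !H.
Qed.

Lemma sum_cell (v : {ffun 'I_d -> 'I_k.+1} -> R) c x : cell c x ->
  \sum_c' v c' * \1_(cell c') x = v c.
Proof.
move=> cx; rewrite (bigD1 c)//= indicE mem_set// mulr1 big1 ?addr0// => c' c'c.
rewrite indicE memNset ?mulr0// => c'x.
by move/eqP : c'c; apply; exact: cell_inj cx.
Qed.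

Lemma measurable_cell c : measurable (cell c).
Proof.
rewrite (_ : cell c = box (low c) (up c) `&`
    \bigcap_(i in [set i | (c i < k)%N])
      ((@tnth d R ^~ i) @^-1` `]-oo, tnth (up c) i[%classic)).
  apply: measurableI; first exact: measurable_box.
  apply: fin_bigcap_measurable => [|i _]; first exact: finite_finset.
  by rewrite -[X in measurable X]setTI; apply: measurable_tnth.
by apply/seteqP; split=> x [? xu]; split=> // i /xu; rewrite /= in_itv.
Qed.

Lemma cell_volume c : (lebesgue_tuple R d (cell c) <=
  (\prod_(i < d) (tnth b i - tnth a i) / k.+1%:R ^+ d)%:E)%E.
Proof.
apply: (@le_trans _ _ (lebesgue_tuple R d (box (low c) (up c)))).
  apply: le_measure; rewrite ?inE; [exact: measurable_cell|exact: measurable_box|].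
  by move=> x [].
rewrite lebesgue_tuple_box; last exact: low_le_up.
rewrite lee_fin (eq_bigr mesh); last first.
  move=> i _; rewrite !tnth_mktuple -natr1; ring.
by rewrite big_split/= prodr_const card_ord exprVn.
Qed.

End grid.

(** The integral of a nonnegative function is a supremum over the simple functions below it, hence
    monotone without measurability. This is what lets a non-Borel f be compared with step
    functions. *)
Lemma ge0_le_integral_nonmeasurable {R : realType} {dT : measure_display}
    {T : measurableType dT} (mu : {measure set T -> \bar R}) (D : set T)
    (f1 f2 : T -> \bar R) :
  (forall x, D x -> (0 <= f1 x)%E) -> (forall x, D x -> (f1 x <= f2 x)%E) ->
  (\int[mu]_(x in D) f1 x <= \int[mu]_(x in D) f2 x)%E.
Proof.
move=> f10 f12; rewrite !ge0_integralE//; last first.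
  by move=> x Dx; apply: le_trans (f12 x Dx); exact: f10.
apply: le_ereal_sup => _ [h hf <-]; exists h => // x; apply: le_trans (hf x) _.
by rewrite /patch; case: ifPn => // /set_mem; exact: f12.
Qed.

Section cell_mass.
Context {R : realType} {d : nat}.
Local Notation Rd := (d.-tuple R).
Local Notation lam := (lebesgue_tuple R d).
Variables (a b : Rd) (M : R) (psi : Rd -> R).
Hypotheses (ab : cle a b).
Hypotheses (mpsi : measurable_fun (box a b) psi).
Hypothesis psi0 : forall x, box a b x -> 0 <= psi x.
Hypothesis psi_lty : (\int[lam]_(x in box a b) (psi x)%:E < +oo)%E.
Implicit Types (f : Rd -> R).

Definition cell_mass k (c : {ffun 'I_d -> 'I_k.+1}) : R :=
  fine (\int[lam]_(x in box a b) (psi x * \1_(cell a b k c) x)%:E).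

Definition weighted_integral f : R :=
  fine (\int[lam]_(x in box a b) (psi x * f x)%:E).

Let mpsi1 k (c : {ffun 'I_d -> 'I_k.+1}) :
  measurable_fun (box a b) (fun x => psi x * \1_(cell a b k c) x).
Proof.
apply: measurable_funM => //; apply: measurable_funTS.
by apply: measurable_indic; exact: measurable_cell.
Qed.

Let psi1_ge0 k (c : {ffun 'I_d -> 'I_k.+1}) x : box a b x ->
  0 <= psi x * \1_(cell a b k c) x.
Proof. by move=> Dx; rewrite mulr_ge0// psi0. Qed.

Lemma weighted_integral_fin f (B : R) :
  (forall x, box a b x -> 0 <= f x <= B) ->
  (\int[lam]_(x in box a b) (psi x * f x)%:E)%E = (weighted_integral f)%:E.
Proof.
move=> fB; rewrite fineK// ge0_fin_numE; last first.
  apply: integral_ge0 => x Dx; have /andP[f0 _] := fB x Dx.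
  by rewrite lee_fin mulr_ge0// psi0.
have [[x0 Dx0]|noD] := pselect (exists x, box a b x); last first.
  rewrite (_ : (\int[lam]_(x in box a b) _)%E = 0%E) ?ltry//.
  by apply: integral0_eq => x Dx; exfalso; apply: noD; exists x.
have B0 : 0 <= B by have /andP[/le_trans] := fB x0 Dx0; apply.
apply: (@le_lt_trans _ _ (\int[lam]_(x in box a b) (B%:E * (psi x)%:E))%E).
  apply: ge0_le_integral_nonmeasurable => x Dx; have /andP[f0 f1] := fB x Dx.
    by rewrite lee_fin mulr_ge0// psi0.
  by rewrite -EFinM lee_fin mulrC ler_wpM2r// psi0.
rewrite ge0_integralZl_EFin//.
- by rewrite lte_mul_pinfty.
- exact: measurable_box.
- exact/measurable_EFinP.
Qed.

Lemma cell_massE k (c : {ffun 'I_d -> 'I_k.+1}) :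
  (\int[lam]_(x in box a b) (psi x * \1_(cell a b k c) x)%:E)%E = (cell_mass k c)%:E.
Proof.
apply: (@weighted_integral_fin (fun x => \1_(cell a b k c) x) 1) => x _.
by rewrite indicE; case: (_ \in _); rewrite /= ?lexx ?ler01.
Qed.

Lemma cell_mass_ge0 k (c : {ffun 'I_d -> 'I_k.+1}) : 0 <= cell_mass k c.
Proof.
rewrite -lee_fin -cell_massE; apply: integral_ge0 => x Dx.
by rewrite lee_fin psi1_ge0.
Qed.

Lemma integral_step k (v : {ffun 'I_d -> 'I_k.+1} -> R) : (forall c, 0 <= v c) ->
  (\int[lam]_(x in box a b) (psi x * \sum_c v c * \1_(cell a b k c) x)%:E)%E =
  (\sum_c v c * cell_mass k c)%:E.
Proof.
move=> v0; under eq_integral => x _.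
  rewrite mulr_sumr -sumEFin.
  under eq_bigr do rewrite mulrCA EFinM.
  over.
rewrite ge0_integral_sum//=.
- rewrite -sumEFin; apply: eq_bigr => c _.
  rewrite ge0_integralZl_EFin//.
  + by rewrite cell_massE EFinM.
  + exact: measurable_box.
  + by move=> x Dx; rewrite lee_fin psi1_ge0.
  + exact/measurable_EFinP.
- exact: measurable_box.
- by move=> c; apply: emeasurable_funM => //; exact/measurable_EFinP.
- by move=> c x Dx; rewrite mule_ge0 ?lee_fin ?psi1_ge0.
Qed.

Lemma sum_cell_mass k : (\int[lam]_(x in box a b) (psi x)%:E)%E =
  (\sum_(c : {ffun 'I_d -> 'I_k.+1}) cell_mass k c)%:E.
Proof.
under [in RHS]eq_bigr do rewrite -[cell_mass _ _]mul1r.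
rewrite -(@integral_step k (fun=> 1))//; apply: eq_integral => x /set_mem Dx.
have [c cx] := cell_cover a b k x Dx.
by rewrite (sum_cell a b k ab (fun=> 1) c x cx) mulr1.
Qed.

Lemma weighted_integral_sandwich k f : shape_class a b M f ->
  \sum_(c : {ffun 'I_d -> 'I_k.+1}) f (up a b k c) * cell_mass k c
    <= weighted_integral f <=
  \sum_(c : {ffun 'I_d -> 'I_k.+1}) f (low a b k c) * cell_mass k c.
Proof.
move=> /shape_class_antitone[fM anti].
have fup c : 0 <= f (up a b k c) by have /andP[] := fM _ (up_box a b k ab c).
have flow c : 0 <= f (low a b k c) by have /andP[] := fM _ (low_box a b k ab c).
rewrite -!lee_fin -(weighted_integral_fin f M fM) -!integral_step//.
apply/andP; split; apply: ge0_le_integral_nonmeasurable => x Dx.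
- rewrite lee_fin mulr_ge0 ?psi0// sumr_ge0// => c _.
  by rewrite mulr_ge0.
- have [c cx] := cell_cover a b k x Dx.
  rewrite (sum_cell a b k ab (fun c => f (up a b k c)) c x cx).
  rewrite lee_fin ler_wpM2l ?psi0//; apply: anti => //; first exact: up_box.
  by case: cx => -[].
- have /andP[f0 _] := fM x Dx.
  by rewrite lee_fin mulr_ge0// psi0.
- have [c cx] := cell_cover a b k x Dx.
  rewrite (sum_cell a b k ab (fun c => f (low a b k c)) c x cx).
  rewrite lee_fin ler_wpM2l ?psi0//; apply: anti => //; first exact: low_box.
  by case: cx => -[].
Qed.

End cell_mass.

Section gap.
Context {R : realType} {d : nat}.
Local Notation Rd := (d.-tuple R).
Local Notation lam := (lebesgue_tuple R d).
Variables (a b : Rd) (M dl : R) (psi : Rd -> R).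
Hypotheses (M0 : 0 <= M) (ab : cle a b) (dl0 : 0 < dl).
Hypotheses (mpsi : measurable_fun (box a b) psi).
Hypothesis psi0 : forall x, box a b x -> 0 <= psi x.
Hypothesis psi_moment :
  (\int[lam]_(x in box a b) (psi x `^ (1 + dl))%:E < +oo)%E.

Let vol : R := \prod_(i < d) (tnth b i - tnth a i).

Let mpow : measurable_fun (box a b) (fun x => psi x `^ (1 + dl)).
Proof. exact: (measurableT_comp (measurable_powR _)). Qed.

Let vol0 : 0 <= vol.
Proof. by apply: prodr_ge0 => i _; rewrite subr_ge0. Qed.

Lemma moment_lty : (\int[lam]_(x in box a b) (psi x)%:E < +oo)%E.
Proof.
have mD : measurable (box a b) by exact: measurable_box.
apply: (@le_lt_trans _ _ (\int[lam]_(x in box a b)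
    (1%:E + (psi x `^ (1 + dl))%:E))%E).
  apply: ge0_le_integral => //.
  - exact/measurable_EFinP.
  - by apply: emeasurable_funD => //; exact/measurable_EFinP.
  - move=> x Dx; rewrite -EFinD lee_fin.
    have := subr_minr_le_powR (psi x) 1 dl (psi0 x Dx) ltr01 dl0.
    have : Num.min (psi x) 1 <= 1 by rewrite ge_min lexx orbT.
    by rewrite powR1 mulr1; lra.
rewrite ge0_integralD//.
- have box_lty : (lam (box a b) < +oo)%E by rewrite lebesgue_tuple_box// ltry.
  by rewrite lte_add_pinfty// integral_cst// mul1e.
- by move=> x _; rewrite lee_fin powR_ge0.
- exact/measurable_EFinP.
Qed.

Let psi_lty := moment_lty.
Local Notation mass := (cell_mass a b psi).
Local Notation D := (cell_mass a b (fun x => psi x `^ (1 + dl))).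

(** The first term is the same for all cells, so the diagonal count applies to it; the second sums
    over the cells to a multiple of the fixed moment of order 1 + dl. *)
Let mass_le k (c : {ffun 'I_d -> 'I_k.+1}) (t : R) : 0 < t ->
  mass k c <= t * (vol / k.+1%:R ^+ d) + t `^ (- dl) * D k c.
Proof.
move=> t0; have mD : measurable (box a b) by exact: measurable_box.
have mC : measurable (cell a b k c) by exact: measurable_cell.
have mI : measurable_fun (box a b) (fun x => \1_(cell a b k c) x : R).
  exact/measurable_funTS/measurable_indic.
have I0 x : 0 <= \1_(cell a b k c) x :> R by rewrite indicE.
have pow0 x : box a b x -> 0 <= psi x `^ (1 + dl) by move=> _; exact: powR_ge0.
rewrite -lee_fin -(cell_massE a b psi mpsi psi0 psi_lty).
apply: (@le_trans _ _ (\int[lam]_(x in box a b)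
    (t%:E * (\1_(cell a b k c) x)%:E +
     (t `^ (- dl))%:E * (psi x `^ (1 + dl) * \1_(cell a b k c) x)%:E))%E).
  apply: ge0_le_integral => //.
  - by move=> x Dx; rewrite lee_fin mulr_ge0// psi0.
  - by apply/measurable_EFinP; exact: measurable_funM.
  - apply: emeasurable_funD; apply: emeasurable_funM => //.
      exact/measurable_EFinP.
    by apply/measurable_EFinP; exact: measurable_funM.
  - move=> x Dx; rewrite -!EFinM -EFinD lee_fin mulrA -mulrDl ler_wpM2r//.
    have := subr_minr_le_powR (psi x) t dl (psi0 x Dx) t0 dl0.
    rewrite -ler_pdivlMr ?powR_gt0// -powRN [_ * t `^ _]mulrC.
    have : Num.min (psi x) t <= t by rewrite ge_min lexx orbT.
    by lra.
rewrite ge0_integralD//; last 4 first.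
- by move=> x _; rewrite -EFinM lee_fin mulr_ge0// ltW.
- by apply: emeasurable_funM => //; exact/measurable_EFinP.
- by move=> x _; rewrite -EFinM lee_fin mulr_ge0 ?mulr_ge0 ?powR_ge0.
- by apply: emeasurable_funM => //; apply/measurable_EFinP; exact: measurable_funM.
rewrite ge0_integralZl_EFin//; last 2 first.
- exact/measurable_EFinP.
- exact: ltW.
rewrite ge0_integralZl_EFin//; last 3 first.
- by move=> x _; rewrite lee_fin mulr_ge0 ?powR_ge0.
- by apply/measurable_EFinP; exact: measurable_funM.
- exact: powR_ge0.
rewrite (cell_massE a b _ mpow pow0 psi_moment) integral_indic//.
rewrite EFinD EFinM (EFinM (t `^ _)) leeD2r// lee_pmul2l ?lte_fin//.
rewrite setIidl; last exact: cell_sub.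
exact: cell_volume.
Qed.

Lemma shape_gap (e : R) : 0 < e -> exists k, forall f, shape_class a b M f ->
  \sum_c f (low a b k c) * mass k c <= \sum_c f (up a b k c) * mass k c + e.
Proof.
move=> e0.
pose C := fine (\int[lam]_(x in box a b) (psi x `^ (1 + dl))%:E)%E.
have pow0 x : box a b x -> 0 <= psi x `^ (1 + dl) by move=> _; exact: powR_ge0.
have I0 : (0%R <= \int[lam]_(x in box a b) (psi x `^ (1 + dl))%:E)%E.
  by apply: integral_ge0 => x _; rewrite lee_fin powR_ge0.
have CE : (\int[lam]_(x in box a b) (psi x `^ (1 + dl))%:E)%E = C%:E.
  by rewrite /C fineK// ge0_fin_numE.
have C0 : 0 <= C by rewrite -lee_fin -CE.
(* [t] is determined by t^dl = q, which makes the tail M C / q at most e / 2; the summand 1 keeps q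
   positive. Only then is [k] taken large against [t], so neither depends on f. *)
pose q := 2 * (M * C + 1) / e.
have q0 : 0 < q by rewrite divr_gt0// mulr_gt0// ltr_wpDl// mulr_ge0.
pose t := q `^ dl^-1.
have t0 : 0 < t by exact: powR_gt0.
have tq : t `^ (- dl) = q^-1.
  by rewrite powRN -powRrM mulVf ?gt_eqF// powRr1// ltW.
pose K := 2 * (t * vol * M * d%:R) / e.
pose k := Num.truncn K.
have kK : 2 * (t * vol * M * d%:R) <= e * k.+1%:R.
  have : K < k.+1%:R by exact: truncnS_gt.
  by rewrite /K ltr_pdivrMr// [_ * e]mulrC => /ltW.
exists k => f Ff; have [fM anti] := (shape_class_antitone a b M f).1 Ff.
pose gap c := f (low a b k c) - f (up a b k c).
have gap0 c : 0 <= gap c.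
  by rewrite subr_ge0 anti//; [exact: low_box|exact: up_box|exact: low_le_up].
have gapM c : gap c <= M.
  have /andP[_ fl] := fM _ (low_box a b k ab c).
  have /andP[fu _] := fM _ (up_box a b k ab c).
  by rewrite /gap; lra.
rewrite -lerBlDl -sumrB.
under eq_bigr do rewrite -mulrBl -/(gap _).
(* In the tail each gap is bounded by [M]; in the volume term it is kept for the diagonal count. *)
apply: (@le_trans _ _ (\sum_c (gap c * (t * (vol / k.+1%:R ^+ d)) + M * q^-1 * D k c))).
  apply: ler_sum => c _.
  apply: (le_trans (ler_wpM2l (gap0 c) (mass_le _ c _ t0))).
  rewrite tq mulrDr lerD2l -mulrA ler_wpM2r// mulr_ge0 ?invr_ge0 ?(ltW q0)//.
  exact: (cell_mass_ge0 a b _ mpow pow0 psi_moment).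
rewrite big_split/= -mulr_suml -mulr_sumr.
have -> : \sum_c D k c = C.
  by apply: EFin_inj; rewrite -CE (sum_cell_mass a b _ ab mpow pow0 psi_moment k).
have H1 : M * q^-1 * C <= e / 2.
  rewrite /q invf_div mulrAC mulrA ler_pdivrMr; last first.
    by rewrite mulr_gt0// ltr_wpDl// mulr_ge0.
  have := mulr_ge0 M0 C0; nra.
have kd0 : 0 < k.+1%:R ^+ d :> R by rewrite exprn_gt0.
have H2 : (\sum_c gap c) * (t * (vol / k.+1%:R ^+ d)) <= e / 2.
  have tv : 0 <= t * vol by rewrite mulr_ge0// ltW.
  have := @sum_diagonal_difference R d k M (fun c => f (grid_point a b k c)) _.
  rewrite -/(\sum_c gap c) => /(_ _)/wrap[].
    by move=> c ck; apply: fM; exact: grid_point_box.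
  set S := \sum_c _ => HS.
  rewrite (_ : S * (t * (vol / k.+1%:R ^+ d)) =
     (k.+1%:R * (t * vol * S)) / (k.+1%:R * k.+1%:R ^+ d)); last first.
    by rewrite -mulf_div divff ?pnatr_eq0// mul1r mulrCA !mulrA [_ * S]mulrAC.
  rewrite ler_pdivrMr ?mulr_gt0//.
  rewrite mulrCA; apply: (le_trans (ler_wpM2l tv HS)).
  rewrite !mulrA ler_pM2r//.
  by move: kK; lra.
lra.
Qed.

End gap.

Lemma lincomb_funE {R : realType} {T : Type} (I : finType) (w : I -> R)
    (v : I -> T -> R) x : (\sum_i w i *: v i) x = \sum_i w i * v i x.
Proof. by rewrite fct_sumE; apply: eq_bigr. Qed.

Lemma shape_class_convex {R : realType} {d : nat} (a b : d.-tuple R) (M : R) :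
  convex_set (shape_class a b M).
Proof.
move=> I w v w0 w1 Kv; apply/shape_class_antitone.
have H i := (shape_class_antitone a b M (v i)).1 (Kv i).
split=> [x Dx|x y Dx Dy xy]; rewrite !lincomb_funE.
  apply/andP; split.
    by apply: sumr_ge0 => i _; have [/(_ x Dx)/andP[? _] _] := H i; rewrite mulr_ge0.
  rewrite -[leRHS]mul1r -w1 mulr_suml; apply: ler_sum => i _.
  by have [/(_ x Dx)/andP[_ ?] _] := H i; rewrite ler_wpM2l.
by apply: ler_sum => i _; have [_ /(_ x y Dx Dy xy)] := H i; exact: ler_wpM2l.
Qed.

Section grid_approximation.
Context {R : realType} {d : nat}.
Local Notation Rd := (d.-tuple R).
Local Notation lam := (lebesgue_tuple R d).
Variables (a b : Rd) (M dl : R) (psi : Rd -> R).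
Hypotheses (M0 : 0 <= M) (ab : cle a b) (dl0 : 0 < dl).
Hypotheses (mpsi : measurable_fun (box a b) psi).
Hypothesis psi0 : forall x, box a b x -> 0 <= psi x.
Hypothesis psi_moment :
  (\int[lam]_(x in box a b) (psi x `^ (1 + dl))%:E < +oo)%E.

Let psi_lty := moment_lty a b dl psi ab dl0 mpsi psi0 psi_moment.
Let gap := shape_gap a b M dl psi M0 ab dl0 mpsi psi0 psi_moment.
Let sandwich := weighted_integral_sandwich a b M psi ab mpsi psi0 psi_lty.
Local Notation mass := (cell_mass a b psi).
Local Notation W := (weighted_integral a b psi).

(** The lower step sum s is linear in the corner values of f, hence the same for both sides; both
    then lie in [s, s + e], for every e > 0. *)
Lemma weighted_integral_affine : affine_on (shape_class a b M) W.
Proof.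
move=> I w v w0 w1 Kv; set f := \sum_i w i *: v i.
have Kf : shape_class a b M f by exact: shape_class_convex.
suff close e : 0 < e -> exists s,
    s <= W f <= s + e /\ s <= \sum_i w i * W (v i) <= s + e.
  apply/eqP; rewrite eq_le; apply/andP; split; apply/ler_addgt0Pr => e e0;
    have [s [/andP[s1 s2] /andP[s3 s4]]] := close e e0; lra.
move=> e0; have [k gapk] := gap e e0.
have sw h : shape_class a b M h ->
    \sum_c h (up a b k c) * mass k c <= W h <= \sum_c h (up a b k c) * mass k c + e.
  move=> Kh; have /andP[-> h2] := sandwich k h Kh.
  exact: le_trans h2 (gapk h Kh).
exists (\sum_c f (up a b k c) * mass k c); split; first exact: sw.
have -> : \sum_c f (up a b k c) * mass k c =
    \sum_i w i * \sum_c v i (up a b k c) * mass k c.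
  under eq_bigr do rewrite /f lincomb_funE mulr_suml.
  rewrite exchange_big/=; apply: eq_bigr => i _.
  by rewrite mulr_sumr; apply: eq_bigr => c _; rewrite mulrA.
apply/andP; split.
  by apply: ler_sum => i _; rewrite ler_wpM2l//; have /andP[] := sw _ (Kv i).
rewrite -[X in _ + X]mul1r -w1 mulr_suml -big_split/=; apply: ler_sum => i _.
by rewrite -mulrDr ler_wpM2l//; have /andP[] := sw _ (Kv i).
Qed.

(** A deterministic statement: [k] is fixed before the sample size, the points and f, and the sample
    enters only through its weighted cell frequencies. The weights [y] will be the values of psi / g
    at the sample points. *)
Lemma sample_deviation_le (e : R) : 0 < e -> exists k,
  forall (n : nat) (x : 'I_n -> Rd) (y : 'I_n -> R) f,
  (forall i, box a b (x i)) -> (forall i, 0 <= y i) -> shape_class a b M f ->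
  `|n%:R^-1 * \sum_i y i * f (x i) - W f| <= e +
    M * \sum_c `|n%:R^-1 * \sum_i y i * \1_(cell a b k c) (x i) - mass k c|.
Proof.
move=> e0; have [k gapk] := gap e e0; exists k => n x y f Dx y0 Kf.
have [fM anti] := (shape_class_antitone a b M f).1 Kf.
pose freq c := n%:R^-1 * \sum_i y i * \1_(cell a b k c) (x i).
rewrite -/(freq _); under eq_bigr do rewrite -/(freq _).
have upM c : 0 <= f (up a b k c) <= M by apply: fM; exact: up_box.
have lowM c : 0 <= f (low a b k c) <= M by apply: fM; exact: low_box.
have freqE (v : {ffun 'I_d -> 'I_k.+1} -> R) : \sum_c v c * freq c =
    n%:R^-1 * \sum_i y i * \sum_c v c * \1_(cell a b k c) (x i).
  rewrite /freq; under eq_bigr do rewrite mulrCA mulr_sumr.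
  rewrite -mulr_sumr exchange_big/=; congr (_ * _); apply: eq_bigr => i _.
  by rewrite mulr_sumr; apply: eq_bigr => c _; rewrite mulrCA.
have n0 : 0 <= n%:R^-1 :> R by rewrite invr_ge0.
have dev (v : {ffun 'I_d -> 'I_k.+1} -> R) : (forall c, 0 <= v c <= M) ->
    `|\sum_c v c * freq c - \sum_c v c * mass k c| <= M * \sum_c `|freq c - mass k c|.
  move=> vM; rewrite -sumrB; apply: (le_trans (ler_norm_sum _ _ _)).
  rewrite mulr_sumr; apply: ler_sum => c _; have /andP[v0 v1] := vM c.
  by rewrite -mulrBr normrM (ger0_norm v0) ler_wpM2r.
have S1 : \sum_c f (up a b k c) * freq c <= n%:R^-1 * \sum_i y i * f (x i).
  rewrite freqE ler_wpM2l//; apply: ler_sum => i _; rewrite ler_wpM2l//.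
  have [c cx] := cell_cover a b k (x i) (Dx i).
  rewrite (sum_cell a b k ab (fun c => f (up a b k c)) c (x i) cx).
  by apply: anti => //; [exact: up_box|case: cx => -[]].
have S2 : n%:R^-1 * \sum_i y i * f (x i) <= \sum_c f (low a b k c) * freq c.
  rewrite freqE ler_wpM2l//; apply: ler_sum => i _; rewrite ler_wpM2l//.
  have [c cx] := cell_cover a b k (x i) (Dx i).
  rewrite (sum_cell a b k ab (fun c => f (low a b k c)) c (x i) cx).
  by apply: anti => //; [exact: low_box|case: cx => -[]].
have /andP[W1 W2] := sandwich k f Kf.
have := gapk f Kf.
have /ler_normlP[D1 D2] := dev _ lowM; have /ler_normlP[D3 D4] := dev _ upM.
move=> G; apply/ler_normlP; split; lra.
Qed.

End grid_approximation.

(** * Sampling and reduction *)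

Section density.
Local Open Scope ereal_scope.
Context {R : realType} {dT : measure_display} {T : measurableType dT}.
Variables (nu mu : {measure set T -> \bar R}) (D : set T) (g : T -> R).
Hypotheses (mD : measurable D) (mg : measurable_fun D g).
Hypothesis g0 : forall x, D x -> (0 <= g x)%R.
Hypothesis nuE : forall A, measurable A -> nu A = \int[mu]_(x in A `&` D) (g x)%:E.

Let density_indic A : measurable A ->
  \int[nu]_x (\1_A x)%:E = \int[mu]_(x in D) (\1_A x * g x)%:E.
Proof.
move=> mA; rewrite integral_indic// setIT nuE// setIC integral_mkcondr.
apply: eq_integral => x _; rewrite patchE indicE.
by case: ifPn => _; rewrite ?mul1r ?mul0r.
Qed.

Import HBNNSimple.

Let density_nnsfun (f : {nnsfun T >-> R}) :
  \int[nu]_x (f x)%:E = \int[mu]_(x in D) (f x * g x)%:E.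
Proof.
under [LHS]eq_integral do rewrite fimfunE -fsumEFin//.
rewrite [LHS]ge0_integral_fsum//; last 2 first.
  - by move=> r; exact/measurable_EFinP/measurableT_comp.
  - by move=> n x _; rewrite EFinM nnfun_muleindic_ge0.
under [RHS]eq_integral.
  move=> x /set_mem xD; rewrite EFinM fimfunE -fsumEFin// ge0_mule_fsuml; last first.
    by move=> r; exact: (nnfun_muleindic_ge0 f r x).
  over.
rewrite [RHS]ge0_integral_fsum//; last 2 first.
  - move=> r; apply: emeasurable_funM; last exact/measurable_EFinP.
    by apply: measurable_funTS; exact/measurable_EFinP/measurableT_comp.
  - by move=> n x Dx; rewrite mule_ge0 ?lee_fin ?g0//; exact: (nnfun_muleindic_ge0 f n x).
apply: eq_fsbigr => r /set_mem [t _ ftr].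
have r0 : (0 <= r)%R by rewrite -ftr.
have mfr : measurable (f @^-1` [set r]) by exact: measurable_sfunP.
rewrite integralZl_indic_nnsfun// density_indic//.
rewrite -ge0_integralZl_EFin//.
- by apply: eq_integral => x _; rewrite -!EFinM mulrA.
- by move=> x Dx; rewrite lee_fin mulr_ge0 ?g0.
- by apply/measurable_EFinP; apply: measurable_funM.
Qed.

Lemma integral_density (h : T -> \bar R) :
  measurable_fun setT h -> (forall x, 0 <= h x) ->
  \int[nu]_x h x = \int[mu]_(x in D) (h x * (g x)%:E).
Proof.
move=> mh h0; pose f := nnsfun_approx measurableT mh.
have f_cvg x : (f n x)%:E @[n --> \oo] --> h x by exact: cvg_nnsfun_approx.
transitivity (lim (\int[nu]_x (f n x)%:E @[n --> \oo])).
  rewrite -monotone_convergence//=.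
  - by apply: eq_integral => x _; apply/esym/cvg_lim.
  - by move=> n; exact/measurable_EFinP.
  - by move=> n x _; rewrite lee_fin.
  - by move=> x _ m n mn; rewrite lee_fin; exact/lefP/nd_nnsfun_approx.
rewrite (_ : \int[mu]_(x in D) _ =
    lim (\int[mu]_(x in D) (f n x * g x)%:E @[n --> \oo])).
  by apply: congr_lim; apply/funext => n /=; exact: density_nnsfun.
rewrite -monotone_convergence//=.
- apply: eq_integral => x _; apply/esym/cvg_lim => //.
  under eq_fun do rewrite EFinM.
  by apply: cvgeZr => //.
- move=> n; apply/measurable_EFinP; apply: measurable_funM => //.
  exact/measurable_funTS.
- by move=> n x Dx; rewrite lee_fin mulr_ge0// g0.
- move=> x Dx m n mn; rewrite lee_fin ler_wpM2r ?g0//.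
  exact/lefP/nd_nnsfun_approx.
Qed.

End density.

Lemma ler_bigmax_sub {R : realDomainType} (I : finType) (P Q : pred I) (F : I -> R) :
  {subset P <= Q} ->
  \big[Num.max/0]_(i | P i) F i <= \big[Num.max/0]_(i | Q i) F i.
Proof.
move=> PQ; apply: bigmax_le => [|i Pi]; first exact: bigmax_ge_id.
by apply: le_bigmax_cond; exact: PQ.
Qed.

Section reducible.
Context {R : realType} {d : nat}.
Local Notation Rd := (d.-tuple R).
Variables (a b : Rd) (M : R) (g : Rd -> R) (n : nat) (x : 'I_n -> Rd).
Hypotheses (M0 : 0 <= M) (g0 : forall y, box a b y -> 0 < g y).
Hypothesis Dx : forall i, box a b (x i).

Let LL := likelihood_ratios g (shape_class a b M).

(* The values at the sample points extend to the least admissible density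
   y |-> max_{i : y <= X_i} L(X_i) g(X_i). *)
Lemma discrete_shape_reducible : finite_dim_reducible LL x (discrete_shape g M x).
Proof.
have gn0 i : g (x i) != 0 by rewrite gt_eqF// g0.
split=> [_ [f /shape_class_antitone[fM anti] <-]|w [wmono wM]].
  split=> [i j ji|i] /=; rewrite !divfK//; first exact: anti.
  exact: fM.
(* The index set shrinks as [y] grows, so [f] is antitone; where no sample point lies above [y], the
   empty maximum takes its default 0. *)
pose f (y : Rd) := \big[Num.max/0]_(i < n | `[< cle y (x i) >]) (w i * g (x i)).
exists (fun y => f y / g y).
  exists f => //; apply/shape_class_antitone; split=> [y _|y z _ _ yz].
    apply/andP; split; first exact: bigmax_ge_id.
    by apply: bigmax_le => // i _; have /andP[] := wM i.
  apply: ler_bigmax_sub => i /asboolP zi; apply/asboolP => k.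
  exact: le_trans (zi k).
move=> i; suff -> : f (x i) = w i * g (x i) by rewrite mulfK.
apply/eqP; rewrite eq_le; apply/andP; split.
  apply: bigmax_le => [|j /asboolP ij]; last exact: wmono.
  by have /andP[] := wM i.
apply: (le_bigmax_cond _ (fun j => w j * g (x j))).
by apply/asboolP => k.
Qed.

Lemma val_Pn_reduced l m (phi : nat -> Rd -> R) mu :
  val_Pn l m phi mu x LL = val_Pn' l m phi mu x (discrete_shape g M x).
Proof.
have [LLw wLL] := discrete_shape_reducible.
congr ereal_sup; apply/seteqP; split => t.
  by move=> [L [LLL Lfeas] <-]; exists (L \o x) => //; split => //; exact: LLw.
move=> [w [/wLL[L LLL Lw] wfeas] <-].
have wE : L \o x = w by apply/funext.
by exists L; [split; rewrite ?wE|rewrite wE].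
Qed.

End reducible.

(** The integrand of the moment of order 1 + dl of psi / g times an indicator, taken under g: one
    factor g cancels, and g^(-dl) is bounded through the lower bound [t1] of g. This converts the
    Lebesgue moment hypothesis into one on the sample. *)
Lemma powR_ratio_le {R : realType} (dl s t t1 u : R) : 0 < dl -> 0 <= s ->
  0 < t1 -> t1 <= t -> 0 <= u <= 1 ->
  (s / t * u) `^ (1 + dl) * t <= t1 `^ (- dl) * s `^ (1 + dl).
Proof.
move=> dl0 s0 t1_gt0 tt1 /andP[u0 u1]; have t0 : 0 < t by exact: lt_le_trans tt1.
have st0 : 0 <= s / t * u by rewrite mulr_ge0// divr_ge0// ltW.
have dl1 : (1 + dl == 0) = false by rewrite gt_eqF// addr_gt0.
rewrite powRD ?dl1// powRr1// mulrAC (@powRD _ s) ?dl1// powRr1// [leRHS]mulrCA.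
have stt0 : 0 <= s / t * u * t by rewrite mulr_ge0// ltW.
apply: ler_pM; rewrite ?powR_ge0//.
  by rewrite mulrAC divfK ?gt_eqF// ler_piMr.
have -> : t1 `^ (- dl) = t1^-1 `^ dl.
  by rewrite -[t1^-1]powR_inv1 ?(ltW t1_gt0)// -powRrM mulN1r.
have ti : 0 <= t1^-1 by rewrite invr_ge0 ltW.
rewrite -powRM//; apply: ge0_ler_powR;
  [exact: ltW|by rewrite nnegrE|by rewrite nnegrE mulr_ge0|].
rewrite -mulrA mulrC ler_wpM2r// -[leRHS]mulr1.
by rewrite ler_pM ?invr_ge0 ?(ltW t0)// lef_pV2.
Qed.

Section sampling_lemmas.
Local Open Scope ereal_scope.
Context {R : realType} {d : nat} {dO : measure_display} {Omega : measurableType dO}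
  {P : probability Omega R}.
Local Notation Rd := (d.-tuple R).
Local Notation lam := (lebesgue_tuple R d).
Variables (a b : Rd) (dl g1 : R) (g psi : Rd -> R) (X : nat -> {RV P >-> Rd}).
Hypotheses (dl01 : (0 < dl <= 1)%R) (g1_gt0 : (0 < g1)%R) (ab : cle a b).
Hypotheses (mg : measurable_fun (box a b) g).
Hypothesis g_ge : forall x, box a b x -> (g1 <= g x)%R.
Hypotheses (mpsi : measurable_fun (box a b) psi).
Hypothesis psi0 : forall x, box a b x -> (0 <= psi x)%R.
Hypothesis psi_moment : \int[lam]_(x in box a b) (psi x `^ (1 + dl))%:E < +oo.
Hypothesis X_pdf : forall i, has_pdf (box a b) g (X i).
Hypothesis X_indep : mutually_independent X.

Lemma has_pdf_ident i (A : set Rd) : measurable A ->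
  P (X i @^-1` A) = P (X 0%N @^-1` A).
Proof. by move=> mA; have [_ ->//] := X_pdf i; have [_ ->] := X_pdf 0%N. Qed.

Lemma mutually_independent_pair i j (A B : set Rd) : i != j ->
  measurable A -> measurable B ->
  P (X i @^-1` A `&` X j @^-1` B) = P (X i @^-1` A) * P (X j @^-1` B).
Proof.
move=> ij mA mB.
have := X_indep [:: i; j] (fun k => if k == i then A else B) _ _.
rewrite /= inE ij/= big_cons big_seq1 eqxx eq_sym (negbTE ij) => <-//; last first.
  by move=> k; case: ifP.
congr (P _); apply/seteqP; split => w /=.
  move=> [Aw Bw] k /=; rewrite !inE => /orP[/eqP ->|/eqP ->]; rewrite ?eqxx//.
  by rewrite eq_sym (negbTE ij).
move=> H; split; first by have := H i; rewrite /= !inE eqxx; apply.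
by have := H j; rewrite /= !inE eqxx orbT eq_sym (negbTE ij); apply.
Qed.

(** Taking the mean under g cancels the factor 1 / g and leaves the Lebesgue mass of the cell
    weighted by [psi]; the strong law applies to this one nonnegative function. *)
Lemma frequency_cvg k (c : {ffun 'I_d -> 'I_k.+1}) : {ae P, forall w,
  ((n%:R^-1 * \sum_(i < n) psi (X i w) / g (X i w) * \1_(cell a b k c) (X i w))%R
   @[n --> \oo] --> cell_mass a b psi k c)}.
Proof.
have dl0 : (0 < dl)%R by case/andP: dl01.
have mD : measurable (box a b) by exact: measurable_box.
have g0 x : box a b x -> (0 < g x)%R by move=> /g_ge; exact: lt_le_trans.
have psi_lty := moment_lty a b dl psi ab dl0 mpsi psi0 psi_moment.
pose h0 x := (psi x / g x * \1_(cell a b k c) x)%R.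
(* Extended by 0, since the strong law wants a function that is measurable and nonnegative
   everywhere; the sample never leaves the box. *)
pose h := h0 \_ (box a b).
have hE x : box a b x -> h x = h0 x by move=> Dx; rewrite /h patchE mem_set.
have h_ge0 x : (0 <= h x)%R.
  rewrite /h patchE; case: ifPn => // /set_mem Dx.
  by rewrite mulr_ge0// divr_ge0 ?psi0// ltW// g0.
have mh : measurable_fun setT h.
  apply/(measurable_restrictT _ mD); apply: measurable_funM.
    apply: measurable_funM => //.
    (* The inverse is measurable as the power -1, with which it agrees because g > 0. *)
    apply: (eq_measurable_fun (fun x => g x `^ (-1))%R).
      by move=> x /set_mem Dx; rewrite powR_inv1// ltW// g0.
    exact: (measurableT_comp (measurable_powR _)).
  by apply/measurable_funTS/measurable_indic; exact: measurable_cell.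
have density (F : Rd -> R) : measurable_fun setT F -> (forall x, 0 <= F x)%R ->
    \int[P]_w (F (X 0%N w))%:E = \int[lam]_(x in box a b) (F x * g x)%:E.
  move=> mF F0.
  transitivity (\int[distribution P (X 0%N)]_x (EFin \o F) x).
    by rewrite ge0_integral_distribution//; exact/measurable_EFinP.
  rewrite (integral_density _ lam (box a b) g)//.
  - by move=> x Dx; rewrite ltW// g0.
  - by move=> A mA; have [_ H] := X_pdf 0%N; exact: H.
  - exact/measurable_EFinP.
have hgE x : box a b x -> (h x * g x = psi x * \1_(cell a b k c) x)%R.
  by move=> Dx; rewrite hE// /h0 mulrAC divfK// gt_eqF// g0.
have mean : \int[P]_w (h (X 0%N w))%:E = (cell_mass a b psi k c)%:E.
  rewrite density// -(cell_massE a b psi mpsi psi0 psi_lty).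
  by apply: eq_integral => x /set_mem Dx; rewrite hgE.
pose C := fine (\int[lam]_(x in box a b) (psi x `^ (1 + dl))%:E).
have CE : \int[lam]_(x in box a b) (psi x `^ (1 + dl))%:E = C%:E.
  rewrite /C fineK// ge0_fin_numE//; apply: integral_ge0 => x _.
  by rewrite lee_fin powR_ge0.
have mpow : measurable_fun (box a b) (fun x => psi x `^ (1 + dl))%R.
  exact: (measurableT_comp (measurable_powR _)).
have moment_h : \int[P]_w (h (X 0%N w) `^ (1 + dl))%:E <= (g1 `^ (- dl) * C)%:E.
  rewrite (density (fun x => h x `^ (1 + dl))%R); last 2 first.
  - exact: (measurableT_comp (measurable_powR _)).
  - by move=> x; exact: powR_ge0.
  rewrite EFinM -CE -ge0_integralZl_EFin ?powR_ge0//; last 2 first.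
  - by move=> x _; rewrite lee_fin powR_ge0.
  - exact/measurable_EFinP.
  apply: ge0_le_integral_nonmeasurable => x Dx.
    by rewrite lee_fin mulr_ge0 ?powR_ge0// ltW// g0.
  rewrite -EFinM lee_fin hE//; apply: powR_ratio_le; rewrite ?psi0 ?g_ge//.
  by rewrite indicE; case: (_ \in _); rewrite /= ?lexx ?ler01.
have := strong_law_pairwise_iid X has_pdf_ident mutually_independent_pair h dl _ _ mh h_ge0
  dl01 mean moment_h.
apply: filterS => w; apply: cvg_trans; apply: near_eq_cvg; apply: nearW => n.
congr (_ * _)%R; apply: eq_bigr => i _; rewrite hE//.
by have [] := X_pdf i.
Qed.

End sampling_lemmas.

(** * Population and sample programs *)

(** [x] will be the value of a sample program, a priori infinite, for instance -oo if infeasible;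
    the two inequalities exclude this once [y] is finite. *)
Lemma abse_sub_le {R : realType} (x y : \bar R) (e : R) : y \is a fin_num ->
  (x <= y + e%:E)%E -> (y <= x + e%:E)%E -> (`|x - y| <= e%:E)%E.
Proof.
case: y => // y _; case: x => [x| |]//.
rewrite -!EFinD !lee_fin => xy yx.
by apply/ler_normlP; split; lra.
Qed.

(** An infimum equal to +oo occurs only for empty [A], and then any positive number serves. *)
Lemma ereal_inf_gt0_bound {R : realType} {T : Type} (A : set T) (g : T -> R) :
  (0 < ereal_inf [set (g x)%:E | x in A])%E ->
  exists2 r, 0 < r & forall x, A x -> r <= g x.
Proof.
have lb x : A x -> (ereal_inf [set (g x)%:E | x in A] <= (g x)%:E)%E.
  by move=> Ax; apply: ereal_inf_lbound; exists x.
move: lb; case: (ereal_inf _) => [r| |]// lb r0; first by exists r.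
by exists 1 => // x /lb.
Qed.

Section equality_directions.
Context {R : realType} {d : nat}.
Variables (l m : nat) (phi : nat -> d.-tuple R -> R) (mu : nat -> R)
  (D : set (d.-tuple R)) (g : d.-tuple R -> R) (LL : set (d.-tuple R -> R)).
Hypothesis interior_pt : (m < l)%N ->
  interior (equality_moments l m phi D g LL) (equality_levels l m mu).

(** Some ball around the equality levels consists of attained moments; half of its radius keeps the
    shifts along the axes strictly inside. [s] selects the sign of the shift. *)
Lemma equality_directions : exists2 r : R, 0 < r &
  forall (s : bool) (i : 'I_(l - m)), exists2 L, LL L &
    forall k : 'I_(l - m), moment phi D g (m + k.+1) L =
      (mu (m + k.+1)%N + (-1) ^+ s * (r * (k == i)%:R))%:E.
Proof.
have [lm|ml] := leqP l m.
  by exists 1 => // s [i]; rewrite (eqP (lm : (l - m == 0)%N)).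
have /nbhs_ballP[e /= e0 ball_e] := interior_pt ml.
exists (e / 2); first by rewrite divr_gt0.
move=> s i.
pose v : 'rV[R]_(l - m) := equality_levels l m mu +
  (-1) ^+ s *: (e / 2 *: delta_mx 0 i).
have /ball_e[L LLL Lv] : ball (equality_levels l m mu) e v.
  split=> // u j; rewrite /ball /= !mxE opprD addNKr normrN normrM normrX normrN1 expr1n mul1r.
  rewrite normrM ger0_norm ?divr_ge0 ?(ltW e0)//.
  apply: (@le_lt_trans _ _ (e / 2 * 1)); last by rewrite mulr1; lra.
  rewrite ler_wpM2l ?divr_ge0 ?(ltW e0)//.
  by case: (_ && _); rewrite ?normr1 ?normr0 ?ler01.
exists L => // k; rewrite Lv !mxE eqxx/=.
by rewrite mulrA [k == i]eq_sym.
Qed.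

End equality_directions.

Lemma strict_slack {R : realType} (m : nat) (c mu : nat -> R) :
  (forall j, (1 <= j <= m)%N -> c j < mu j) ->
  exists2 s, 0 < s & forall j, (1 <= j <= m)%N -> c j <= mu j - s.
Proof.
elim: m => [|m IH] cmu; first by exists 1 => // -[].
have [j /andP[j1 jm]|s s0 cs] := IH; first by apply: cmu; rewrite j1 ltnW.
exists (Num.min s (mu m.+1 - c m.+1)).
  by rewrite lt_min s0 subr_gt0 cmu// leqnn.
move=> j /andP[j1]; rewrite leq_eqVlt => /predU1P[->|jm].
  by rewrite lerBrDl -lerBrDr ge_min lexx orbT.
apply: (le_trans (cs j _)); first by rewrite j1.
by rewrite lerD2l lerN2 ge_min lexx.
Qed.

(** The positive part for [false] and the negative part for [true]; the Boolean index lets both be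
    treated at once. *)
Definition signed_part {R : realType} {T : Type} (s : bool) (f : T -> R) (x : T) : R :=
  Num.max ((-1) ^+ s * f x) 0.

Lemma signed_part_ge0 {R : realType} {T : Type} (s : bool) (f : T -> R) x :
  0 <= signed_part s f x.
Proof. by rewrite le_max lexx orbT. Qed.

Lemma signed_partB {R : realType} {T : Type} (f : T -> R) x :
  f x = signed_part false f x - signed_part true f x.
Proof.
rewrite /signed_part expr0 expr1 mul1r mulN1r.
by case: (leP (f x) 0) => f0; case: (leP (- f x) 0) => f1; lra.
Qed.

(** Lowering the exponent is harmless on a box of finite volume: the lower power is at most 1 +
    |f|^(1+delta), by comparing |f| with 1. *)
Lemma signed_part_moment {R : realType} {d : nat} (a b : d.-tuple R) (delta : R)
    (s : bool) (f : d.-tuple R -> R) : cle a b ->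
  measurable_fun (box a b) f ->
  (\int[lebesgue_tuple R d]_(x in box a b) (`|f x| `^ (1 + delta))%:E < +oo)%E ->
  0 < delta ->
  (\int[lebesgue_tuple R d]_(x in box a b)
     (signed_part s f x `^ (1 + Num.min delta 1))%:E < +oo)%E.
Proof.
move=> ab mf f_moment delta0; have mD : measurable (box a b) by exact: measurable_box.
have mpow : measurable_fun (box a b) (fun x => `|f x| `^ (1 + delta)).
  apply: (measurableT_comp (measurable_powR _)).
  exact: measurableT_comp.
apply: (@le_lt_trans _ _ (\int[lebesgue_tuple R d]_(x in box a b)
    (1%:E + (`|f x| `^ (1 + delta))%:E))%E).
  apply: ge0_le_integral_nonmeasurable => x Dx.
    by rewrite lee_fin powR_ge0.
  rewrite -EFinD lee_fin.
  have p0 := signed_part_ge0 s f x.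
  have pf : signed_part s f x <= `|f x|.
    rewrite ge_max normr_ge0 andbT; apply: (le_trans (ler_norm _)).
    by rewrite normrM normrX normrN1 expr1n mul1r.
  have dl0 : 0 < 1 + Num.min delta 1 :> R by rewrite addr_gt0// lt_min delta0 ltr01.
  apply: (@le_trans _ _ (`|f x| `^ (1 + Num.min delta 1))).
    by apply: ge0_ler_powR; rewrite ?nnegrE// ltW.
  have [f1|f1] := leP `|f x| 1.
    apply: (@le_trans _ _ 1); last by rewrite lerDl powR_ge0.
    have pow1 : 1 `^ (1 + Num.min delta 1) = 1 :> R by rewrite powR1.
    rewrite -[leRHS]pow1.
    by apply: ge0_ler_powR; rewrite ?nnegrE// ltW.
  apply: (@le_trans _ _ (`|f x| `^ (1 + delta))); last by rewrite lerDr.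
  by apply: ler_powR; rewrite ?(ltW f1)// lerD2l ge_min lexx.
have box_lty : (lebesgue_tuple R d (box a b) < +oo)%E.
  by rewrite lebesgue_tuple_box// ltry.
rewrite ge0_integralD//.
- by rewrite lte_add_pinfty// integral_cst// mul1e.
- exact/measurable_EFinP.
Qed.

(** If some [tnth b i] were below [tnth a i] the box would be empty and the density would integrate
    to 0. *)
Lemma pdf_box_le {R : realType} {d : nat} (a b : d.-tuple R) g :
  is_pdf (box a b) g -> cle a b.
Proof.
move=> [_ _ g1] i; rewrite leNgt; apply/negP => ba.
have box0 x : ~ box a b x.
  by move=> [ax xb]; have := le_trans (ax i) (xb i); rewrite leNgt ba.
suff : (0 = 1 :> \bar R)%E by move/eqP; rewrite eqe eq_sym oner_eq0.
by rewrite -g1 integral0_eq// => x /box0.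
Qed.

Section program.
Context {R : realType} {d : nat}.
Local Notation Rd := (d.-tuple R).
Local Notation lam := (lebesgue_tuple R d).
Variables (a b : Rd) (M : R) (l m : nat) (phi : nat -> Rd -> R) (mu : nat -> R)
  (g : Rd -> R) (dl : R).
Hypotheses (M0 : 0 <= M) (ml : (m <= l)%N) (ab : cle a b).
Hypothesis dl01 : 0 < dl <= 1.
Hypothesis g0 : forall x, box a b x -> 0 < g x.
Hypothesis mphi : forall j, (j <= l)%N -> measurable_fun (box a b) (phi j).
Hypothesis phi_moment : forall s j, (j <= l)%N ->
  (\int[lam]_(x in box a b) (signed_part s (phi j) x `^ (1 + dl))%:E < +oo)%E.

Let K := shape_class a b M.
Let LL := likelihood_ratios g K.
Let ratio (f : Rd -> R) (x : Rd) : R := f x / g x.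
Let psi s j := signed_part s (phi j).
Let dl0 : 0 < dl. Proof. by case/andP: dl01. Qed.

Let mpsi s j : (j <= l)%N -> measurable_fun (box a b) (psi s j).
Proof.
move=> jl; apply: measurable_maxr => //; apply: measurable_funM => //.
exact: mphi.
Qed.

Let psi0 s j x : box a b x -> 0 <= psi s j x.
Proof. by move=> _; exact: signed_part_ge0. Qed.

Let psi_lty s j : (j <= l)%N -> (\int[lam]_(x in box a b) (psi s j x)%:E < +oo)%E.
Proof.
move=> jl; exact: (moment_lty a b dl _ ab dl0 (mpsi s j jl) (psi0 s j)
  (phi_moment s j jl)).
Qed.

Definition population_moment (j : nat) (f : Rd -> R) : R :=
  weighted_integral a b (psi false j) f - weighted_integral a b (psi true j) f.

Definition empirical_moment n (x : 'I_n -> Rd) (j : nat) (f : Rd -> R) : R :=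
  sample_moment phi x j (ratio f \o x).

(** The factor g cancels, and f >= 0 gives (phi f)^+ = phi^+ f and (phi f)^- = phi^- f, which are
    the two parts that define the integral; both are finite, so their difference is a real
    number. *)
Lemma moment_population j f : (j <= l)%N -> K f ->
  moment phi (box a b) g j (ratio f) = (population_moment j f)%:E.
Proof.
move=> jl Kf; have [fM _] := (shape_class_antitone a b M f).1 Kf.
have f0 x : box a b x -> 0 <= f x by move=> /fM /andP[].
rewrite /moment /expect integralE EFinB.
rewrite -!(weighted_integral_fin a b _ (mpsi _ j jl) (psi0 _ j) (psi_lty _ j jl) f M fM).
congr (_ - _)%E; apply: eq_integral => x /set_mem Dx.
  rewrite /ratio funeposE mulrA divfK ?gt_eqF ?g0//.
  rewrite -EFin_max /psi /signed_part expr0 mul1r; congr EFin.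
  by rewrite maxr_pMl ?f0// mul0r.
rewrite /ratio funenegE mulrA divfK ?gt_eqF ?g0//.
rewrite -EFinN -EFin_max /psi /signed_part expr1 mulN1r; congr EFin.
by rewrite maxr_pMl ?f0// mul0r mulNr.
Qed.

Lemma population_affine j : (j <= l)%N -> affine_on K (population_moment j).
Proof.
move=> jl I w v w0 w1 Kv.
have aff s := weighted_integral_affine a b M dl (psi s j) M0 ab dl0 (mpsi s j jl)
  (psi0 s j) (phi_moment s j jl) I w v w0 w1 Kv.
by rewrite /population_moment !aff -sumrB; apply: eq_bigr => i _; rewrite mulrBr.
Qed.

Lemma empirical_affine n (x : 'I_n -> Rd) j : affine_on K (empirical_moment n x j).
Proof.
move=> I w v w0 w1 Kv; rewrite /empirical_moment /sample_moment.
rewrite (eq_bigr (fun i => \sum_k w k * (phi j (x i) * ratio (v k) (x i)))); last first.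
  move=> i _; rewrite /= /ratio lincomb_funE mulr_suml mulr_sumr.
  by apply: eq_bigr => k _; rewrite -mulrA mulrCA.
rewrite exchange_big/= mulr_sumr; apply: eq_bigr => k _.
by rewrite -mulr_sumr mulrCA.
Qed.

(** For k = 0 the grid has a single cell, the whole box. Summing over j and the signs gives one
    constant valid for all moments. *)
Let bound : R := \sum_(j < l.+1) \sum_(s : bool)
  M * \sum_(c : {ffun 'I_d -> 'I_1}) cell_mass a b (psi s j) 0 c.

Lemma population_bounded j f : (j <= l)%N -> K f -> `|population_moment j f| <= bound.
Proof.
move=> jl Kf; have [fM _] := (shape_class_antitone a b M f).1 Kf.
pose B (i : nat) s := M * \sum_(c : {ffun 'I_d -> 'I_1}) cell_mass a b (psi s i) 0 c.
have B0 (i : nat) s : (i <= l)%N -> 0 <= B i s.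
  move=> il; rewrite mulr_ge0// sumr_ge0// => c _.
  exact: (cell_mass_ge0 a b _ (mpsi s i il) (psi0 s i) (psi_lty s i il)).
have W0B s : 0 <= weighted_integral a b (psi s j) f <= B j s.
  have /andP[w1 w2] := weighted_integral_sandwich a b M _ ab (mpsi s j jl) (psi0 s j)
    (psi_lty s j jl) 0%N f Kf.
  have mass0 c := cell_mass_ge0 a b _ (mpsi s j jl) (psi0 s j) (psi_lty s j jl) 0%N c.
  apply/andP; split.
    apply: le_trans w1; apply: sumr_ge0 => c _; rewrite mulr_ge0//.
    by have /andP[] := fM _ (up_box a b 0 ab c).
  apply: (le_trans w2); rewrite /B mulr_sumr; apply: ler_sum => c _.
  by rewrite ler_wpM2r//; have /andP[] := fM _ (low_box a b 0 ab c).
have jB : B j false + B j true <= bound.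
  rewrite /bound (bigD1 (Ordinal (jl : (j < l.+1)%N)))//= big_bool/= -/(B j _) -/(B j _).
  rewrite [B j true + _]addrC lerDl sumr_ge0// => i _; rewrite big_bool/=.
  by rewrite addr_ge0// (B0 i)// -ltnS.
apply: le_trans jB; rewrite /population_moment.
by have /andP[? ?] := W0B false; have /andP[? ?] := W0B true; apply/ler_normlP; split; lra.
Qed.

Lemma empirical_signed n (x : 'I_n -> Rd) j f :
  empirical_moment n x j f =
  n%:R^-1 * (\sum_i psi false j (x i) / g (x i) * f (x i)) -
  n%:R^-1 * (\sum_i psi true j (x i) / g (x i) * f (x i)).
Proof.
rewrite /empirical_moment /sample_moment -mulrBr -sumrB; congr (_ * _).
apply: eq_bigr => i _; rewrite [phi j (x i)](signed_partB (phi j)) /= /ratio.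
by rewrite -/(psi _ _) -/(psi _ _); ring.
Qed.


Lemma feasible_ratio f : K f ->
  feasible l m phi mu (box a b) g (ratio f) <-> satisfies l m mu population_moment f.
Proof.
move=> Kf.
have ml_le j : (1 <= j <= m)%N -> (j <= l)%N by move=> /andP[_ jm]; exact: leq_trans ml.
split=> -[ineq eq]; split=> j jm.
- by have := ineq j jm; rewrite moment_population ?ml_le// lee_fin.
- have /andP[_ jl] := jm.
  by have := eq j jm; rewrite moment_population// => -[].
- by rewrite moment_population ?ml_le// lee_fin; exact: ineq.
- have /andP[_ jl] := jm.
  by rewrite moment_population// eq.
Qed.

Hypothesis slater : exists2 L0, LL L0 & strictly_feasible l m phi mu (box a b) g L0.
Hypothesis interior_pt : (m < l)%N ->
  interior (equality_moments l m phi (box a b) g LL) (equality_levels l m mu).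

(** The transfer is applied twice, from the sample to the population and back, with the population
    as reference both times; hence [eta] depends neither on n nor on the sample. *)
Lemma val_close (e : R) : 0 < e -> exists2 eta : R, 0 < eta &
  forall n (x : 'I_n -> Rd),
  uniformly_close K l eta population_moment (empirical_moment n x) ->
  (`|val_Pn l m phi mu x LL - val_P l m phi mu (box a b) g LL| <= e%:E)%E.
Proof.
move=> e0; have [_ [f0 Kf0 <-] [f0_lt f0_eq]] := slater.
have ml_le j : (1 <= j <= m)%N -> (j <= l)%N by move=> /andP[_ jm]; exact: leq_trans ml.
have eq_le (k : 'I_(l - m)) : (m + k.+1 <= l)%N.
  by rewrite -leq_subRL// ltn_ord.
have [sg sg0 slack] : exists2 sg : R, 0 < sg &
    forall j, (1 <= j <= m)%N -> population_moment j f0 <= mu j - sg.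
  apply: strict_slack => j jm; rewrite -lte_fin -moment_population ?ml_le//.
  exact: f0_lt.
have f0E j : (m < j <= l)%N -> population_moment j f0 = mu j.
  move=> /[dup] jm /andP[_ jl]; apply: EFin_inj.
  by rewrite -moment_population//; exact: f0_eq.
have [r r0 dirs] := equality_directions l m phi mu (box a b) g LL interior_pt.
have dir (s : bool) : forall i : 'I_(l - m), exists f, K f /\ forall k : 'I_(l - m),
    population_moment (m + k.+1)%N f = mu (m + k.+1)%N + (-1) ^+ s * (r * (k == i)%:R).
  move=> i; have [_ [f Kf <-] fE] := dirs s i; exists f; split=> // k.
  by apply: EFin_inj; rewrite -moment_population// fE.
have /choice[vp vpP] := dir false; have /choice[vm vmP] := dir true.
have vpE (k i : 'I_(l - m)) :
    population_moment (m + k.+1)%N (vp i) = mu (m + k.+1)%N + r * (k == i)%:R.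
  by rewrite (vpP i).2 expr0 mul1r.
have vmE (k i : 'I_(l - m)) :
    population_moment (m + k.+1)%N (vm i) = mu (m + k.+1)%N - r * (k == i)%:R.
  by rewrite (vmP i).2 expr1 mulN1r.
have [eta eta0 transfer] := satisfies_transfer K l m mu ml (shape_class_convex a b M)
  population_moment bound population_bounded f0 vp vm r sg r0 sg0 Kf0
  (fun i => (vpP i).1) (fun i => (vmP i).1) slack f0E vpE vmE e e0.
exists eta => // n x close.
have close0 : uniformly_close K l eta population_moment population_moment.
  by move=> j f _ _; rewrite subrr normr0 ltW.
have emp_aff j : (j <= l)%N -> affine_on K (empirical_moment n x j).
  by move=> _; exact: empirical_affine.
have popE f : K f -> moment phi (box a b) g 0 (ratio f) = (population_moment 0 f)%:E.
  exact: moment_population.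
have pop_le f : K f -> satisfies l m mu population_moment f ->
    ((population_moment 0 f)%:E <= val_P l m phi mu (box a b) g LL)%E.
  move=> Kf /(feasible_ratio f Kf) feas_f; apply: ereal_sup_ubound.
  by exists (ratio f); [split=> //; exists f|exact: popE].
have emp_le f : K f -> satisfies l m mu (empirical_moment n x) f ->
    ((empirical_moment n x 0 f)%:E <= val_Pn l m phi mu x LL)%E.
  move=> Kf feas_f; apply: ereal_sup_ubound.
  by exists (ratio f) => //; split=> //; exists f.
have f0_feas : satisfies l m mu population_moment f0.
  by split=> // j jm; apply: (le_trans (slack j jm)); rewrite gerBl ltW.
apply: abse_sub_le.
- rewrite fin_numElt; apply/andP; split.
    exact: lt_le_trans (ltNyr _) (pop_le f0 Kf0 f0_feas).
  apply: (@le_lt_trans _ _ bound%:E); last exact: ltry.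
  apply: ge_ereal_sup => _ [_ [[f Kf <-] _] <-].
  rewrite popE// lee_fin; apply: (le_trans (ler_norm _)).
  exact: population_bounded.
- apply: ge_ereal_sup => _ [_ [[f Kf <-] feas_f] <-].
  have [f' [Kf' feas' obj]] := transfer _ _ population_affine close close0 f Kf feas_f.
  apply: le_trans (leeD2r _ (pop_le f' Kf' feas')).
  by rewrite -EFinD lee_fin -lerBlDr.
- apply: ge_ereal_sup => _ [_ [[f Kf <-] feas_f] <-].
  have [f' [Kf' feas' obj]] := transfer _ _ emp_aff close0 close f Kf
    ((feasible_ratio f Kf).1 feas_f).
  apply: le_trans (leeD2r _ (emp_le f' Kf' feas')).
  by rewrite popE// -EFinD lee_fin -lerBlDr.
Qed.

(** Of the three [eta], two are the grid errors of the positive and the negative part and the third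
    bounds the deviations of the cell averages. *)
Lemma empirical_deviation (eta : R) : 0 < eta ->
  exists k : bool -> nat -> nat, forall n (x : 'I_n -> Rd),
  (forall i, box a b (x i)) ->
  \sum_(j < l.+1) \sum_(s : bool) M * \sum_c `|n%:R^-1 *
    \sum_i psi s j (x i) / g (x i) * \1_(cell a b (k s j) c) (x i) -
    cell_mass a b (psi s j) (k s j) c| <= eta ->
  uniformly_close K l (3 * eta) population_moment (empirical_moment n x).
Proof.
move=> eta0.
have /choice[k kP] : forall sj : bool * nat, exists k, (sj.2 <= l)%N ->
    forall n (x : 'I_n -> Rd) (y : 'I_n -> R) f,
    (forall i, box a b (x i)) -> (forall i, 0 <= y i) -> K f ->
    `|n%:R^-1 * \sum_i y i * f (x i) - weighted_integral a b (psi sj.1 sj.2) f| <= eta +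
      M * \sum_c `|n%:R^-1 * \sum_i y i * \1_(cell a b k c) (x i) -
                   cell_mass a b (psi sj.1 sj.2) k c|.
  move=> [s j] /=; have [jl|jl] := leqP j l; last by exists 0%N.
  have [k kP] := sample_deviation_le a b M dl _ M0 ab dl0 (mpsi s j jl) (psi0 s j)
    (phi_moment s j jl) eta eta0.
  by exists k => _; exact: kP.
exists (fun s j => k (s, j)) => n x Dx sum_le j f jl Kf.
pose dev s i := M * \sum_c `|n%:R^-1 *
    \sum_i0 psi s i (x i0) / g (x i0) * \1_(cell a b (k (s, i)) c) (x i0) -
    cell_mass a b (psi s i) (k (s, i)) c|.
have dev0 s i : 0 <= dev s i by rewrite mulr_ge0// sumr_ge0.
have dev_le : dev false j + dev true j <= eta.
  apply: le_trans sum_le.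
  rewrite (bigD1 (Ordinal (jl : (j < l.+1)%N)))//= big_bool/=.
  rewrite -/(dev true j) -/(dev false j) [dev true j + _]addrC lerDl.
  by apply: sumr_ge0 => i _; rewrite big_bool/= addr_ge0// dev0.
have y0 s i : 0 <= psi s j (x i) / g (x i).
  by rewrite divr_ge0 ?psi0// ltW// g0.
have := kP (false, j) jl n x _ f Dx (y0 false) Kf; rewrite /= -/(dev false j).
have := kP (true, j) jl n x _ f Dx (y0 true) Kf; rewrite /= -/(dev true j).
rewrite empirical_signed /population_moment.
move=> /ler_normlP[? ?] /ler_normlP[? ?]; apply/ler_normlP.
by have := dev0 true j; have := dev0 false j; split; lra.
Qed.

End program.

Theorem corollary2 (R : realType) (d : nat) (hd : (2 <= d)%N)
    (a b : d.-tuple R) (M : R) (hM : 0 < M)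
    (l m : nat) (hml : (m <= l)%N)
    (phi : nat -> d.-tuple R -> R) (mu : nat -> R)
    (phi_meas : forall j, (j <= l)%N -> measurable_fun (box a b) (phi j))
    (total_mass : exists2 j, (1 <= j <= l)%N &
       forall x, box a b x -> phi j x = 1)
    (g : d.-tuple R -> R) (g_pdf : is_pdf (box a b) g)
    (g_inf : (0 < ereal_inf [set (g x)%:E | x in box a b])%E)
    (g_sup : (ereal_sup [set (g x)%:E | x in box a b] < +oo)%E)
    (delta : R) (hdelta : 0 < delta)
    (phi_int : forall j, (j <= l)%N ->
       (\int[lebesgue_tuple R d]_(x in box a b)
          (`|phi j x| `^ (1 + delta))%:E < +oo)%E)
    (slater : exists2 L0, likelihood_ratios g (shape_class a b M) L0 &
       strictly_feasible l m phi mu (box a b) g L0)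
    (interior_pt : (m < l)%N ->
       interior (equality_moments l m phi (box a b) g
                   (likelihood_ratios g (shape_class a b M)))
         (equality_levels l m mu))
    (dO : measure_display) (Omega : measurableType dO)
    (P : probability Omega R) (X : nat -> {RV P >-> d.-tuple R})
    (X_pdf : forall i, has_pdf (box a b) g (X i))
    (X_indep : mutually_independent X) :
  let LL := likelihood_ratios g (shape_class a b M) in
  let sample n w : 'I_n -> d.-tuple R := fun i => X i w in
  (forall (n : nat) (w : Omega), (0 < n)%N ->
     finite_dim_reducible LL (sample n w) (discrete_shape g M (sample n w)) /\
     val_Pn l m phi mu (sample n w) LL =
       val_Pn' l m phi mu (sample n w) (discrete_shape g M (sample n w))) /\
  as_outer_cvg P (fun n w => val_Pn l m phi mu (sample n w) LL)
    (val_P l m phi mu (box a b) g LL).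
Proof.
move=> LL sample.
have ab := pdf_box_le a b g g_pdf.
have [mg g0 _] := g_pdf.
have [g1 g1_gt0 g_ge] := ereal_inf_gt0_bound (box a b) g g_inf.
have Dsample n w i : box a b (sample n w i) by have [+ _] := X_pdf i; exact.
split=> [n w _|].
  split; first exact: (discrete_shape_reducible a b M g n _ (ltW hM)).
  exact: (val_Pn_reduced a b M g n _ (ltW hM)).
pose dl := Num.min delta 1.
have dl01 : 0 < dl <= 1 by rewrite /dl lt_min hdelta ltr01/= ge_min lexx orbT.
have phi_moment s j (jl : (j <= l)%N) := signed_part_moment a b delta s (phi j)
  ab (phi_meas j jl) (phi_int j jl) hdelta.
have mpsi (s : bool) j : (j <= l)%N -> measurable_fun (box a b) (signed_part s (phi j)).
  move=> jl; apply: measurable_maxr => //; apply: measurable_funM => //.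
  exact: phi_meas.
apply: as_outer_cvg_criterion => e e0.
have [eta eta0 close] := val_close a b M l m phi mu g dl (ltW hM) hml ab dl01 g0
  phi_meas phi_moment slater interior_pt e e0.
(* A third of [eta], to make up for the factor 3 in [empirical_deviation]. *)
have eta3 : 0 < eta / 3 by rewrite divr_gt0.
have [k kP] := empirical_deviation a b M l phi g dl (ltW hM) ab dl01 g0
  phi_meas phi_moment (eta / 3) eta3.
pose F (s : bool) j n w (c : {ffun 'I_d -> 'I_(k s j).+1}) : R :=
  n%:R^-1 * \sum_(i < n) signed_part s (phi j) (X i w) / g (X i w) *
    \1_(cell a b (k s j) c) (X i w).
exists (fun n w => \sum_(j < l.+1) \sum_(s : bool) M * \sum_c
  `|F s j n w c - cell_mass a b (signed_part s (phi j)) (k s j) c|), (eta / 3).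
split=> //.
- move=> n; apply: measurable_sum => j; apply: measurable_sum => s.
  apply: measurable_funM => //; apply: measurable_sum => c.
  apply: measurableT_comp => //; apply: measurable_funB => //.
  apply: measurable_funM => //; apply: measurable_sum => i.
  have mX (f : d.-tuple R -> R) : measurable_fun (box a b) f ->
      measurable_fun setT (fun w => f (X i w)).
    move=> mf; apply: (measurable_comp (measurable_box a b) _ mf) => //.
    by move=> _ [w _ <-]; exact: (Dsample n w i).
  apply: measurable_funM; last first.
    apply: (mX (fun x => \1_(cell a b (k s j) c) x)).
    by apply/measurable_funTS/measurable_indic; exact: measurable_cell.
  apply: measurable_funM; first by apply: mX; apply: mpsi; rewrite -ltnS.
  apply: (eq_measurable_fun (fun w => g (X i w) `^ (-1))).
    by move=> w _; rewrite powR_inv1// ltW// g0//; exact: (Dsample n w i).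
  by apply: (measurableT_comp (measurable_powR _)); exact: mX.
- have : {ae P, forall w, forall (j : 'I_l.+1) (s : bool) c,
      (F s j n w c @[n --> \oo] --> cell_mass a b (signed_part s (phi j)) (k s j) c)}.
    apply: filter_forall => j; apply: filter_forall => s; apply: filter_forall => c.
    have jl : (j <= l)%N by rewrite -ltnS.
    apply: (frequency_cvg a b dl g1 g _ X dl01 g1_gt0 ab mg g_ge (mpsi s j jl)) => //.
    - by move=> x _; exact: signed_part_ge0.
    - exact: phi_moment.
  apply: filterS => w Fw.
  (* The limit 0 is written as a sum of the same shape, so that convergence can be taken term by
     term. *)
  rewrite [X in _ --> X](_ : 0 = \sum_(j < l.+1) \sum_(s : bool) M *
    \sum_(c : {ffun 'I_d -> 'I_(k s j).+1}) 0); last first.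
    by rewrite big1// => j _; rewrite big1// => s _; rewrite big1 ?mulr0.
  apply: cvg_big => [|j _]; first exact: add_continuous.
  apply: cvg_big => [|s _]; first exact: add_continuous.
  apply: cvgM; first exact: cvg_cst.
  apply: cvg_big => [|c _]; first exact: add_continuous.
  rewrite -(normr0 R).
  apply: cvg_norm; rewrite -[X in _ --> X](subrr (cell_mass a b (signed_part s (phi j)) (k s j) c)).
  by apply: cvgB; [exact: Fw|exact: cvg_cst].
- move=> n w _ Wn; apply: close; rewrite -(@divfK _ 3 _ eta)// [_ * 3]mulrC.
  exact: (kP n (sample n w)).
Qed.
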